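(* Let $\mathfrak{F}=\{f\in B(\mathcal X):\|f\|_\infty\le1\}$. The following are equivalent: (i) there exists a unique invariant probability measure $\mu$ for $\Phi$ such that $\lim_{t\to\infty}\|P_t^*\nu-\mu\|_{TV}=0$ for every $\nu\in\mathcal P(\mathcal X)$; (ii) $\Phi$ is uniformly eventually continuous with respect to $\mathfrak F$ on $\mathcal X$ and there exists $z\in\mathcal X$ such that $\Phi$ satisfies $(\mathcal C_1)$ at $z$; (iii) there exists $z\in\mathcal X$ such that $\Phi$ is uniformly eventually continuous with respect to $\mathfrak F$ at $z$ and satisfies $(\mathcal C_1)$ at $z$.
   Context: Standing setting: $(\mathcal{X},\rho)$ is a Polish space; $\Phi=\{\Phi_t\}_{t\ge0}$ is a càdlàg Feller Markov process on $\mathcal{X}$ with transition kernels $P_t(x,\cdot)$; $P_tf(x)=\int f\,dP_t(x,\cdot)$ for bounded Borel $f$; $P_t^*\nu(A)=\int P_t(x,A)\nu(dx)$. $B(\mathcal X)$ is the set of Borel real functions, $\mathcal P(\mathcal X)$ the Borel probability measures, $B(z,r)$ the open ball. $\|\mu-\nu\|_{TV}=\sup_{\|f\|_\infty\le1}|\int f\,d\mu-\int f\,d\nu|$. $(\mathcal C_1)$ at $z$: for every $r>0$, $\inf_{x\in\mathcal X}\liminf_{t\to\infty}P_t(x,B(z,r))>0$. $\Phi$ is uniformly eventually continuous with respect to $\mathfrak F$ at $x$ if $\limsup_{x'\to x}\limsup_{t\to\infty}\sup_{f\in\mathfrak F}|P_tf(x')-P_tf(x)|=0$; ''on $\mathcal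 X$'' means at every point. *)

(* Defs.v *)
From HB Require Import structures.
From mathcomp Require Import all_boot all_order all_algebra.
From mathcomp Require Import all_classical all_reals all_analysis.
Set Implicit Arguments.
Unset Strict Implicit.
Unset Printing Implicit Defensive.
Import Order.TTheory GRing.Theory Num.Theory.
Import numFieldNormedType.Exports.
Local Open Scope classical_set_scope.
Local Open Scope ring_scope.

Notation BorelSpace X := (@g_sigma_algebraType X (@open X)).

(** Polish space: [ball] is the open ball of a (genuine) metric [rho],
    complete w.r.t. it (built into [completePseudoMetricType]), and separable. *)
Definition is_metric_of (R : realType) (X : pseudoMetricType R) (rho : X -> X -> R) :=
  [/\ forall x y, 0 <= rho x y,
      forall x y, rho x y = 0 <-> x = y,
      forall x y, rho x y = rho y x,
      forall x y z, rho x z <= rho x y + rho y z &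
      forall x r, ball x r = [set y | rho x y < r]].

Definition separable_space (X : topologicalType) :=
  exists D : set X, countable D /\ dense D.

Definition unit_ball_Bfun (R : realType) (X : pointedType) (TX : set (set X))
  (f : X -> R) :=
  measurable_fun [set: g_sigma_algebraType TX] f /\ forall x, `|f x| <= 1.

Definition Pf (R : realType) (X : pointedType) (TX : set (set X))
  (P : R -> R.-pker (g_sigma_algebraType TX) ~> (g_sigma_algebraType TX))
  (t : R) (f : X -> R) (x : X) : R :=
  Rintegral (P t x) [set: g_sigma_algebraType TX] f.

Section pushK.
Context d (T : measurableType d) (R : realType).
Variables (k : R.-ker T ~> T) (nu : {measure set T -> \bar R}).

Definition pushK (A : set T) : \bar R := (\int[nu]_x k x A)%E.

Let pushK0 : pushK set0 = 0%E.
Proof.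
by rewrite /pushK (eq_integral (cst 0%E)) ?integral0// => y _; rewrite measure0.
Qed.

Let pushK_ge0 U : (0 <= pushK U)%E. Proof. exact: integral_ge0. Qed.

Let pushK_sigma_additive : semi_sigma_additive pushK.
Proof.
move=> U mU tU mUU; rewrite [X in _ --> X](_ : _ =
  (\int[nu]_y (\sum_(n <oo) k y (U n)))%E); last first.
  apply: eq_integral => V _.
  by apply/esym/cvg_lim => //; exact/measure_semi_sigma_additive.
apply/cvg_closeP; split.
  by apply: is_cvg_nneseries => n _ _; exact: integral_ge0.
rewrite closeE// integral_nneseries// => n.
exact: measurable_kernel k _ (mU n).
Qed.

HB.instance Definition _ := isMeasure.Build _ _ R
  pushK pushK0 pushK_ge0 pushK_sigma_additive.

End pushK.

Definition tv_dist (R : realType) (X : pointedType) (TX : set (set X))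
  (mu nu : {measure set (g_sigma_algebraType TX) -> \bar R}) : \bar R :=
  ereal_sup [set (`| \int[mu]_x (f x)%:E - \int[nu]_x (f x)%:E |)%E
            | f in @unit_ball_Bfun R X TX].

(* Main.v *)
Require Import Defs.
From HB Require Import structures.
From mathcomp Require Import all_boot all_order all_algebra.
From mathcomp Require Import all_classical all_reals all_analysis.
From mathcomp Require Import measurable_realfun ring lra.
Import Order.TTheory GRing.Theory Num.Theory.
Import numFieldNormedType.Exports.
Set Implicit Arguments.
Unset Strict Implicit.
Unset Printing Implicit Defensive.
Local Open Scope classical_set_scope.
Local Open Scope ring_scope.

(** The implication (i) => (ii) only needs a point of the support of [mu], which
    exists by separability.

    For (iii) => (i), let [alpha] be the supremum over pairs of points of the
    asymptotic total variation distance between the two orbits. Running both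
    orbits for a long time, then integrating over their positions, the pairs
    landing in [ball z delta] contribute at most [2 * eps] by uniform eventual
    continuity and have mass at least [c ^+ 2] by C1, so
    [alpha <= alpha - c ^+ 2 * (alpha - 2 * eps)] unless [alpha <= 2 * eps].
    Hence [alpha = 0] and all orbits merge in total variation.

    It remains to find an invariant probability. By the Feller property the sets
    of points whose orbit is uniformly close to that of [z] after time [N] are
    closed, and they cover the space, so Baire's argument gives a ball, charged
    by the orbit of [z], almost all points of which lie in one of these sets.
    The Feller property and C1 bound the mass that the orbit puts on this ball
    away from 0; therefore the laws [P_n z] asymptotically dominate a fixed
    multiple of [P_N z], up to a small error. An ultralimit of [P_n z] is a
    finitely additive content, invariant because orbits merge, and this
    domination makes its countably additive part nonzero. That part is the
    largest measure below the ultralimit, hence invariant as well. *)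

(** * Integration against measures of total mass 1 *)

Section unit_mass_integral.
Context d (T : measurableType d) (R : realType) (mu : {measure set T -> \bar R}).
Hypothesis mu1 : mu setT = 1%E.
Implicit Types f g : T -> R.

Lemma bounded_integrable f (M : R) : measurable_fun setT f ->
  (forall x, `|f x| <= M) -> mu.-integrable setT (EFin \o f).
Proof.
move=> mf fM; apply: measurable_bounded_integrable => //.
  by rewrite [X in (X < _)%E](_ : _ = 1%E) ?ltry.
exists M; split; first exact: num_real.
by move=> y My x _; exact: le_trans (fM x) (ltW My).
Qed.

Lemma Rintegral_unit_cst (r : R) : \int[mu]_x r = r.
Proof. by rewrite Rintegral_cst// [X in fine X](_ : _ = 1%E) ?mulr1. Qed.

Lemma le_Rintegral_bounded f g (M : R) :
  measurable_fun setT f -> measurable_fun setT g ->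
  (forall x, `|f x| <= M) -> (forall x, `|g x| <= M) ->
  (forall x, f x <= g x) -> \int[mu]_x f x <= \int[mu]_x g x.
Proof.
by move=> mf mg fM gM fg; apply: le_Rintegral => //;
  [exact: bounded_integrable fM | exact: bounded_integrable gM].
Qed.

Lemma RintegralB_bounded f g (M : R) :
  measurable_fun setT f -> measurable_fun setT g ->
  (forall x, `|f x| <= M) -> (forall x, `|g x| <= M) ->
  \int[mu]_x (f x - g x) = \int[mu]_x f x - \int[mu]_x g x.
Proof.
by move=> mf mg fM gM; apply: RintegralB => //;
  [exact: bounded_integrable fM | exact: bounded_integrable gM].
Qed.

Lemma RintegralD_bounded f g (M : R) :
  measurable_fun setT f -> measurable_fun setT g ->
  (forall x, `|f x| <= M) -> (forall x, `|g x| <= M) ->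
  \int[mu]_x (f x + g x) = \int[mu]_x f x + \int[mu]_x g x.
Proof.
by move=> mf mg fM gM; apply: RintegralD => //;
  [exact: bounded_integrable fM | exact: bounded_integrable gM].
Qed.

Lemma normr_Rintegral_le f (M : R) : measurable_fun setT f ->
  (forall x, `|f x| <= M) -> `|\int[mu]_x f x| <= M.
Proof.
move=> mf fM; apply: (le_trans (le_normr_Rintegral _ _)) => //.
  exact: bounded_integrable fM.
rewrite -[leRHS]Rintegral_unit_cst; apply: (@le_Rintegral_bounded _ _ M) => //.
- exact: measurableT_comp.
- by move=> x; rewrite normr_id.
- by move=> x; rewrite ger0_norm// (le_trans _ (fM x)).
Qed.

Lemma Rintegral_bounded_EFin f (M : R) : measurable_fun setT f ->
  (forall x, `|f x| <= M) -> (\int[mu]_x f x)%:E = (\int[mu]_x (f x)%:E)%E.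
Proof.
move=> mf fM; rewrite /Rintegral fineK//; apply: integrable_fin_num => //.
exact: bounded_integrable fM.
Qed.

Lemma Rintegral_indic (A : set T) : measurable A ->
  \int[mu]_x \1_A x = fine (mu A).
Proof. by move=> mA; rewrite /Rintegral integral_indic// setIT. Qed.

Lemma normr_indic_le1 (A : set T) x : `|\1_A x : R| <= 1.
Proof. by rewrite indicE; case: (_ \in _); rewrite ?normr1 ?normr0. Qed.

Lemma unit_mass_fin_num (A : set T) : measurable A -> mu A \is a fin_num.
Proof.
move=> mA; rewrite ge0_fin_numE// (le_lt_trans _ (ltry 1))// -mu1.
by apply: le_measure; rewrite ?inE.
Qed.

Lemma unit_mass_fine_le1 (A : set T) : measurable A -> 0 <= fine (mu A) <= 1.
Proof.
move=> mA; rewrite fine_ge0//= -lee_fin fineK ?unit_mass_fin_num// -mu1.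
by apply: le_measure; rewrite ?inE.
Qed.

End unit_mass_integral.

Lemma eq_measure_Rintegral d (T : measurableType d) (R : realType)
    (m1 m2 : {measure set T -> \bar R}) (f : T -> R) :
  (forall A, measurable A -> m1 A = m2 A) ->
  \int[m1]_x f x = \int[m2]_x f x.
Proof.
move=> m12; congr fine; apply: eq_measure_integral => A mA _; exact: m12.
Qed.

Section unit_mass_probability.
Context d (T : measurableType d) (R : realType) (mu : {measure set T -> \bar R}).

(** The proof of mass 1 is an argument, so that the structure of probability can be attached to this
    copy of [mu]. *)
Definition unit_mass_probability of mu setT = 1%E : set T -> \bar R := mu.

Hypothesis mu1 : mu setT = 1%E.

HB.instance Definition _ := Measure.copy (unit_mass_probability mu1) mu.
HB.instance Definition _ :=
  Measure_isProbability.Build _ _ _ (unit_mass_probability mu1) mu1.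

End unit_mass_probability.

(** * Integrals against the image of a measure under a kernel *)

Section integral_pushK.
Context d (T : measurableType d) (R : realType).
Variables (k : R.-pker T ~> T) (nu : {measure set T -> \bar R}).
Hypothesis nu1 : nu setT = 1%E.

Lemma pushK_setT : pushK k nu setT = 1%E.
Proof.
rewrite /pushK (eq_integral (cst 1%E)) ?integral_cst// ?nu1 ?mul1e//.
by move=> x _; rewrite prob_kernel.
Qed.

(** [pushK k nu] is the composition of the constant kernel [nu] on [unit] with [k], so the integral
    formula for composed kernels applies. *)
Lemma ge0_integral_pushK (f : T -> \bar R) : (forall x, (0 <= f x)%E) ->
  measurable_fun setT f ->
  (\int[pushK k nu]_x f x = \int[nu]_x \int[k x]_y f y)%E.
Proof.
move=> f0 mf.
pose nu' : probability T R := unit_mass_probability nu1.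
have mnu : measurable_fun [set: unit] (fun=> nu' : pprobability T R).
  exact: measurable_cst.
have := @integral_kcomp _ _ _ unit T T R (kprobability mnu)
  (kernel.kernel_snd k) tt f f0 mf.
move=> <-; apply: eq_measure_integral => A mA _; rewrite /=.
by [].
Qed.

(** Adding [M] makes [f] nonnegative, where measurability of kernel integrals applies; [M] is
    subtracted afterwards. *)
Lemma measurable_fun_Rintegral_kernel (f : T -> R) (M : R) :
  measurable_fun setT f -> (forall x, `|f x| <= M) ->
  measurable_fun setT (fun x => \int[k x]_y f y).
Proof.
move=> mf fM.
have -> : (fun x => \int[k x]_y f y) =
    (fun x => fine (\int[k x]_y (f y + M)%:E)%E - M).
  apply/funext => x; rewrite -/(Rintegral (k x) setT (fun y => f y + M)).
  rewrite (@RintegralD_bounded _ _ _ _ (prob_kernel x) _ _ M)//.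
    by rewrite Rintegral_unit_cst ?prob_kernel// addrK.
  by move=> ?; rewrite ger0_norm// (le_trans _ (fM x)).
apply: measurable_funB => //; apply: measurableT_comp => //.
apply: measurable_fun_integral_kernel.
- by move=> U mU; exact: measurable_kernel.
- by move=> y; rewrite lee_fin; move: (fM y); rewrite ler_norml; lra.
- by apply/measurable_EFinP; exact: measurable_funD.
Qed.

Lemma normr_Rintegral_kernel_le (f : T -> R) (M : R) :
  measurable_fun setT f -> (forall x, `|f x| <= M) ->
  forall x, `|\int[k x]_y f y| <= M.
Proof. by move=> mf fM x; apply: normr_Rintegral_le => //; exact: prob_kernel. Qed.

Lemma Rintegral_pushK (f : T -> R) (M : R) :
  measurable_fun setT f -> (forall x, `|f x| <= M) ->
  \int[pushK k nu]_x f x = \int[nu]_x \int[k x]_y f y.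
Proof.
move=> mf fM.
have M0 : 0 <= M by rewrite (le_trans _ (fM point)).
have cM : `|M| <= M by rewrite ger0_norm.
have mfM : measurable_fun setT (fun y => f y + M) by exact: measurable_funD.
have fMM x : `|f x + M| <= M + M.
  by apply: (le_trans (ler_normD _ _)); rewrite lerD ?cM.
(* The nonnegative case is applied to [f + M]; the constant then cancels because all measures
   involved have mass 1. *)
have : \int[pushK k nu]_x (f x + M) = \int[nu]_x \int[k x]_y (f y + M).
  rewrite /Rintegral ge0_integral_pushK//.
  - congr fine; apply: eq_integral => x _.
    by rewrite -(@Rintegral_bounded_EFin _ _ _ _ (prob_kernel x) _ (M + M)).
  - by move=> x; rewrite lee_fin; move: (fM x); rewrite ler_norml; lra.
  - exact/measurable_EFinP.
rewrite (RintegralD_bounded (mu := pushK k nu) pushK_setT mf _ fM (fun=> cM))//.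
rewrite (Rintegral_unit_cst pushK_setT).
under [in RHS]eq_Rintegral => x _.
  rewrite (@RintegralD_bounded _ _ _ _ (prob_kernel x) _ _ M)//.
  rewrite (Rintegral_unit_cst (prob_kernel x)); over.
rewrite (@RintegralD_bounded _ _ _ _ nu1 _ _ M)//.
- by rewrite (Rintegral_unit_cst nu1) => /addIr.
- exact: measurable_fun_Rintegral_kernel fM.
- exact: normr_Rintegral_kernel_le.
Qed.

End integral_pushK.

(** States that the limit superior of [|u n|] is at most [a]. *)
Definition asymp_le (R : realType) (u : nat -> R) (a : R) :=
  forall e, 0 < e -> \forall n \near \oo, `|u n| <= a + e.

(** * Integrals of asymptotically bounded sequences *)

Section asymp_le_integral.
Context d (T : measurableType d) (R : realType) (Q : {measure set T -> \bar R}).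
Hypothesis Q1 : Q setT = 1%E.
Variables (h : nat -> T -> R) (M a b : R) (B : set T).
Hypothesis mh : forall n, measurable_fun setT (h n).
Hypothesis hM : forall n x, `|h n x| <= M.
Hypothesis mB : measurable B.
Hypothesis hB : forall x, B x -> asymp_le (h ^~ x) a.
Hypothesis hNB : forall x, ~ B x -> asymp_le (h ^~ x) b.

Let phi x := b - (b - a) * \1_B x.
Let k n x := Num.max (`|h n x| - phi x) 0.
Let K := M + `|a| + `|b|.

Let phiB x : B x -> phi x = a.
Proof. by move=> Bx; rewrite /phi indicE mem_set// mulr1 subKr. Qed.

Let phiNB x : ~ B x -> phi x = b.
Proof. by move=> Bx; rewrite /phi indicE memNset// mulr0 subr0. Qed.

Let phi_bound x : `|phi x| <= `|a| + `|b|.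
Proof. by have [/phiB->|/phiNB->] := pselect (B x); rewrite ?lerDl ?lerDr. Qed.

Let mphi : measurable_fun setT phi.
Proof.
apply: measurable_funB => //; exact: measurable_funM.
Qed.

Let mk n : measurable_fun setT (k n).
Proof.
apply: measurable_maxr => //; apply: measurable_funB => //.
exact: measurableT_comp.
Qed.

Let M0 : 0 <= M. Proof. exact: le_trans (hM 0 point). Qed.

Let k_ge0 n x : 0 <= k n x. Proof. by rewrite /k le_max lexx orbT. Qed.

Let k_bound n x : `|k n x| <= K.
Proof.
rewrite ger0_norm// /k ge_max; apply/andP; split; last first.
  by rewrite /K !addr_ge0.
have := hM n x; have := phi_bound x; rewrite ler_norml => /andP[]; rewrite /K.
by move: (phi x) `|h n x| `|a| `|b| => p q s t; lra.
Qed.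

Let k_cvg0 x : k n x @[n --> \oo] --> (0 : R).
Proof.
apply/cvgrPdist_le => e e0; have : asymp_le (h ^~ x) (phi x).
  by have [Bx|Bx] := pselect (B x); [rewrite phiB//; exact: hB|
    rewrite phiNB//; exact: hNB].
move=> /(_ e e0); apply: filterS => n hn.
by rewrite sub0r normrN ger0_norm// /k ge_max (ltW e0) andbT lerBlDl.
Qed.

Let Rintegral_k_cvg0 : \int[Q]_x k n x @[n --> \oo] --> (0 : R).
Proof.
have H : (\int[Q]_x (k n x)%:E @[n --> \oo] --> \int[Q]_x (cst 0 x))%E.
  apply: (@dominated_cvg _ _ _ _ setT measurableT _ _ (fun=> K%:E)) => //.
  - by move=> n; exact/measurable_EFinP.
  - by move=> x _; apply: cvg_EFin; [exact: nearW|exact: k_cvg0].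
  - apply: (@bounded_integrable _ _ _ _ Q1 (fun=> K) `|K|) => //.
  - by move=> n x _ /=; rewrite lee_fin.
rewrite integral0 in H.
exact: (fine_cvg H).
Qed.

(** A reverse Fatou argument. The bound is the integral of [phi], equal to [a] on [B] and to [b]
    elsewhere. The excess [k n] of [|h n|] over [phi] tends to 0 pointwise and is bounded by [K], so
    its integral tends to 0 by dominated convergence. *)
Lemma asymp_le_Rintegral :
  asymp_le (fun n => \int[Q]_x h n x) (b - (b - a) * fine (Q B)).
Proof.
move=> e e0; move/cvgrPdist_le : Rintegral_k_cvg0 => /(_ e e0).
apply: filterS => n; rewrite sub0r normrN => kn.
apply: (le_trans (le_normr_Rintegral _ _)) => //.
  exact: bounded_integrable (hM n).
have KM x : `|h n x| <= K by rewrite (le_trans (hM n x))// /K -addrA lerDl addr_ge0.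
have Kphi x : `|phi x| <= K.
  by rewrite (le_trans (phi_bound x))// /K -addrA lerDr.
have mhn : measurable_fun setT (fun x => `|h n x|) by exact: measurableT_comp.
have mpk : measurable_fun setT (fun x => phi x + k n x) by exact: measurable_funD.
have : \int[Q]_x `|h n x| <= \int[Q]_x (phi x + k n x).
  apply: (@le_Rintegral_bounded _ _ _ _ Q1 _ _ (K + K)) => //.
  - by move=> x; rewrite normr_id (le_trans (KM x))// lerDl (le_trans _ (KM x)).
  - by move=> x; rewrite (le_trans (ler_normD _ _))// lerD.
  - by move=> x; rewrite -lerBlDl /k le_max lexx.
move=> /le_trans; apply.
rewrite (@RintegralD_bounded _ _ _ _ Q1 _ _ K)// lerD//; last first.
  exact: le_trans (ler_norm _) kn.
rewrite le_eqVlt; apply/orP; left; apply/eqP.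
have bB x : `|(b - a) * \1_B x| <= `|a| + `|b|.
  rewrite normrM (le_trans (ler_wpM2l _ (normr_indic_le1 _ _ x)))// mulr1.
  by rewrite (le_trans (ler_normB _ _))// addrC.
rewrite /phi (@RintegralB_bounded _ _ _ _ Q1 _ _ (`|a| + `|b|))//.
- rewrite Rintegral_unit_cst// RintegralZl ?Rintegral_indic//.
  apply: (bounded_integrable Q1 _ (@normr_indic_le1 _ _ _ B)).
  exact: measurable_indic.
- by apply: measurable_funM => //; exact: measurable_indic.
- by move=> _; rewrite lerDr.
Qed.

End asymp_le_integral.

(** * Merging of orbits *)

Lemma nat_threshold (R : realType) (Q : R -> Prop) :
  (exists T : R, forall t, 0 <= t -> T <= t -> Q t) ->
  exists N : nat, forall n, (N <= n)%N -> Q n%:R.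
Proof.
move=> [T HT]; exists (Num.trunc `|T|).+1 => n Nn; apply: HT => //.
rewrite (le_trans (ler_norm _))// (le_trans (ltW (truncnS_gt _)))//.
by rewrite ler_nat.
Qed.

Section asymp_le_theory.
Context (R : realType).
Implicit Types (u v : nat -> R) (a b : R).

Lemma asymp_leW u a b : a <= b -> asymp_le u a -> asymp_le u b.
Proof.
move=> ab ua e e0; apply: filterS (ua e e0) => n /le_trans; apply.
by rewrite lerD2r.
Qed.

Lemma asymp_le_shift u a (N : nat) :
  asymp_le (fun n => u (n + N)%N) a -> asymp_le u a.
Proof.
move=> ua e e0; have [m _ um] := ua e e0; exists (m + N)%N => // n /= mn.
have Nn : (N <= n)%N by rewrite (leq_trans _ mn)// leq_addl.
by rewrite -(subnK Nn); apply: um => /=; rewrite -(leq_add2r N) subnK.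
Qed.

Lemma asymp_le_bound u a : (forall n, `|u n| <= a) -> asymp_le u a.
Proof. by move=> ua e e0; apply: nearW => n; rewrite (le_trans (ua n))// lerDl ltW. Qed.

End asymp_le_theory.

Lemma Rintegral_dirac d (T : measurableType d) (R : realType) (x : T)
  (f : T -> R) : measurable_fun setT f -> \int[\d_x]_y f y = f x.
Proof.
move=> mf; rewrite /Rintegral integral_dirac//; last exact/measurable_EFinP.
by rewrite diracT mul1e.
Qed.

Section merging.
Context d (T : measurableType d) (R : realType) (P : R -> R.-pker T ~> T).
Hypothesis HCK : forall s t : R, 0 <= s -> 0 <= t ->
  forall (x : T) (A : set T), measurable A ->
  P (s + t) x A = (\int[P s x]_y P t y A)%E.
Implicit Types (f : T -> R) (x y z : T).

Let P1 t x : P t x setT = 1%E. Proof. exact: prob_kernel. Qed.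

Definition unit_ball f := measurable_fun setT f /\ forall x, `|f x| <= 1.

(** Convertible with [Pf], but stated on any measurable type. *)
Definition Ptf (t : R) f x := \int[P t x]_y f y.

Lemma unit_ball_Ptf t f : unit_ball f -> unit_ball (Ptf t f).
Proof.
move=> [mf f1]; split; first exact: measurable_fun_Rintegral_kernel f1.
exact: normr_Rintegral_kernel_le.
Qed.

Lemma PtfD s t f x : 0 <= s -> 0 <= t -> unit_ball f ->
  Ptf (s + t) f x = \int[P s x]_y Ptf t f y.
Proof.
move=> s0 t0 [mf f1]; rewrite -(Rintegral_pushK _ _ mf f1)//.
by apply: eq_measure_Rintegral => A mA; exact: HCK.
Qed.

Lemma Rintegral_Ptf_nat (m N : nat) f x : unit_ball f ->
  Ptf (m + N)%:R f x = \int[P N%:R x]_y Ptf m%:R f y.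
Proof. by move=> Ff; rewrite addnC natrD PtfD. Qed.

(* Quantifying over sequences of test functions at integer times, instead of
   taking the supremum over all of them, avoids non-measurable suprema. *)
Definition merging (a : R) := forall f : nat -> T -> R,
  (forall n, unit_ball (f n)) -> forall x y,
  asymp_le (fun n => Ptf n%:R (f n) x - Ptf n%:R (f n) y) a.

Lemma merging2 : merging 2.
Proof.
move=> f Ff x y; apply: asymp_le_bound => n.
have [_ b] := unit_ball_Ptf n%:R (Ff n).
by rewrite (le_trans (ler_normB _ _))// (natrD _ 1 1) lerD.
Qed.

Lemma merging_ge0 a : merging a -> 0 <= a.
Proof.
move=> ma; apply/ler_addgt0Pr => e e0.
have F0 (n : nat) : unit_ball (cst 0).
  by split=> // x; rewrite normr0.
have [N _ /(_ N)] := ma (fun=> cst 0) F0 point point e e0.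
by rewrite subrr normr0; apply => /=.
Qed.

(** * Contraction of the merging constant *)

Section contraction.
Variables (z : T) (B : set T) (eps c a : R).
Hypothesis mB : measurable B.
Hypothesis c0 : 0 <= c.
Hypothesis epsa : 2 * eps <= a.
Hypothesis Bz : forall u, B u -> exists t0 : R, forall t, 0 <= t -> t0 <= t ->
  forall f, unit_ball f -> `|Ptf t f u - Ptf t f z| <= eps.
Hypothesis Bc : forall x, exists t0 : R, forall t, 0 <= t -> t0 <= t ->
  (c%:E <= P t x B)%E.

Let Bzn u : B u -> exists N : nat, forall n : nat, (N <= n)%N ->
  forall f, unit_ball f -> `|Ptf n%:R f u - Ptf n%:R f z| <= eps.
Proof.
by move=> /Bz; exact: nat_threshold.
Qed.

Let Bcn x : exists N : nat, forall n : nat, (N <= n)%N -> c <= fine (P n%:R x B).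
Proof.
have [N HN] := nat_threshold (Bc x); exists N => n /HN.
by rewrite -(fineK (unit_mass_fin_num (P1 _ x) mB)).
Qed.

(** After a waiting time [N] both orbits have laws charging [B] by at least [c]. Pairs of positions
    in [B] differ asymptotically by at most [2 * eps], all other pairs by at most [a]. Averaging
    over one position and then over the other gives [a - (a - 2 * eps) * Qx B * Qy B]. *)
Lemma merging_contraction : merging a -> merging (a - c ^+ 2 * (a - 2 * eps)).
Proof.
move=> ma f Ff x y.
have [N1 HN1] := Bcn x; have [N2 HN2] := Bcn y.
pose N := maxn N1 N2; apply: (@asymp_le_shift _ _ _ N).
(* By the semigroup law, the value at time [m + N] from [x] is the integral of [g m] against [Qx],
   and likewise from [y]. *)
pose g m := Ptf m%:R (f (m + N)%N).
have Fg m : unit_ball (g m) by exact: unit_ball_Ptf.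
pose Qx := P N%:R x; pose Qy := P N%:R y.
have Qx1 : Qx setT = 1%E by exact: P1.
have Qy1 : Qy setT = 1%E by exact: P1.
pose h m v := \int[Qx]_u (g m u - g m v).
have hE m v : h m v = \int[Qx]_u g m u - g m v.
  rewrite /h (@RintegralB_bounded _ _ _ _ Qx1 _ _ 1)//.
  - by rewrite Rintegral_unit_cst.
  - by have [] := Fg m.
  - by have [] := Fg m.
  - by move=> _; have [] := Fg m.
have gm : merging a -> forall u v, asymp_le (fun m => g m u - g m v) a.
  by move=> {}ma u v; exact: (ma (fun m => f (m + N)%N)).
have g2 v m u : `|g m u - g m v| <= 2.
  have [_ b] := Fg m.
  by rewrite (le_trans (ler_normB _ _))// (natrD _ 1 1) lerD.
have mgB v m : measurable_fun setT (fun u => g m u - g m v).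
  by apply: measurable_funB => //; have [] := Fg m.
have gB u v : B u -> B v -> asymp_le (fun m => g m u - g m v) (2 * eps).
  move=> /Bzn[Nu Hu] /Bzn[Nv Hv] e e0; exists (maxn Nu Nv) => // n /=.
  rewrite geq_max => /andP[un vn].
  (* Both points are compared with [z], at a cost of [eps] each. *)
  have -> : g n u - g n v = (g n u - g n z) - (g n v - g n z) by ring.
  apply: (le_trans (ler_normB _ _)).
  have := Hu _ un _ (Ff (n + N)%N); have := Hv _ vn _ (Ff (n + N)%N).
  by rewrite -/(g n); move: `|_ - _| `|_ - _| => p q; lra.
have hB v : B v -> asymp_le (h ^~ v) (a - (a - 2 * eps) * fine (Qx B)).
  move=> Bv; apply: (asymp_le_Rintegral Qx1 (mgB v) (g2 v) mB) => u Bu.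
    exact: gB.
  exact: gm.
(* Off [B] nothing is gained: the averaging lemma is used with the bound [a] on both sides. *)
have hNB v : ~ B v -> asymp_le (h ^~ v) a.
  move=> _; have := asymp_le_Rintegral Qx1 (mgB v) (g2 v) mB
    (fun u _ => gm ma u v) (fun u _ => gm ma u v).
  by rewrite subrr mul0r subr0.
have mhm m : measurable_fun setT (h m).
  rewrite (_ : h m = fun v => \int[Qx]_u g m u - g m v); last exact/funext.
  by apply: measurable_funB => //; have [] := Fg m.
have h2 m v : `|h m v| <= 2 by exact: normr_Rintegral_le.
have := asymp_le_Rintegral Qy1 mhm h2 mB hB hNB.
rewrite subKr => H.
have xc : c <= fine (Qx B) by apply: HN1; exact: leq_maxl.
have yc : c <= fine (Qy B) by apply: HN2; exact: leq_maxr.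
apply: asymp_leW; last first.
  move: H; congr (asymp_le _ _); apply/funext => m.
  rewrite !Rintegral_Ptf_nat// -/(g m) -/Qx -/Qy.
  under eq_Rintegral do rewrite hE.
  rewrite (@RintegralB_bounded _ _ _ _ Qy1 _ _ 1)//.
  - by rewrite Rintegral_unit_cst.
  - by have [] := Fg m.
  - by move=> _; apply: normr_Rintegral_le => //; have [] := Fg m.
  - by have [] := Fg m.
rewrite lerB// mulrC -mulrA; apply: ler_wpM2l; first by rewrite subr_ge0.
by rewrite expr2 ler_pM.
Qed.

End contraction.

(** Ensures that the infimum of all merging constants is itself one. *)
Lemma merging_closed (a : R) :
  (forall e, 0 < e -> exists2 b, b <= a + e & merging b) -> merging a.
Proof.
move=> H f Ff x y e e0; have e20 : 0 < e / 2 by rewrite divr_gt0.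
have [b ba mb] := H _ e20; apply: filterS (mb f Ff x y _ e20) => n /le_trans.
by apply; move: ba; lra.
Qed.

(** If the least merging constant exceeded some [e > 0], the contraction with [eps = e / 2] would
    produce a strictly smaller one. *)
Lemma merging0 (z : T) :
  (forall eps : R, 0 < eps -> exists (B : set T) (c : R), [/\ measurable B, 0 < c,
     forall u, B u -> exists t0 : R, forall t, 0 <= t -> t0 <= t ->
       forall f, unit_ball f -> `|Ptf t f u - Ptf t f z| <= eps &
     forall x, exists t0 : R, forall t, 0 <= t -> t0 <= t -> (c%:E <= P t x B)%E]) ->
  merging 0.
Proof.
move=> H; pose S := [set a | merging a].
have S0 : has_inf S.
  by split; [exists 2; exact: merging2|exists 0 => a /merging_ge0].
have mi : merging (inf S).
  apply: merging_closed => e e0; have [b Sb /ltW bi] := inf_adherent e0 S0.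
  by exists b.
suff : inf S <= 0.
  by move=> i0; rewrite (_ : 0 = inf S)//; apply/le_anti; rewrite i0 merging_ge0.
apply/ler_addgt0Pr => e e0; rewrite add0r leNgt; apply/negP => ei.
have [|B [c [mB c0 HB Hc]]] := H (e / 2); first by rewrite divr_gt0.
have ei' : 2 * (e / 2) <= inf S by rewrite mulrC divfK ?ltW.
have := merging_contraction mB (ltW c0) ei' HB Hc mi.
move=> /(ge_inf S0.2); rewrite lerBrDr gerDl leNgt => /negP; apply.
by rewrite mulr_gt0 ?exprn_gt0// subr_gt0 mulrC divfK.
Qed.

Section merging_measures.
Hypothesis merge : merging 0.
Variables nu1 nu2 : {measure set T -> \bar R}.
Hypotheses (nu1T : nu1 setT = 1%E) (nu2T : nu2 setT = 1%E).

(** Merging of points is averaged over [nu1] and then over [nu2], by the same lemma as in the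
    contraction, here with equal bounds. *)
Lemma merging_measures_seq (f : nat -> T -> R) : (forall n, unit_ball (f n)) ->
  asymp_le (fun n => \int[nu1]_x Ptf n%:R (f n) x - \int[nu2]_x Ptf n%:R (f n) x) 0.
Proof.
move=> Ff; pose g n := Ptf n%:R (f n).
have Fg n : unit_ball (g n) by exact: unit_ball_Ptf.
pose h n v := \int[nu1]_u (g n u - g n v).
have hE n v : h n v = \int[nu1]_u g n u - g n v.
  rewrite /h (@RintegralB_bounded _ _ _ _ nu1T _ _ 1)//.
  - by rewrite Rintegral_unit_cst.
  - by have [] := Fg n.
  - by have [] := Fg n.
  - by move=> _; have [] := Fg n.
have g2 v n u : `|g n u - g n v| <= 2.
  have [_ b] := Fg n.
  by rewrite (le_trans (ler_normB _ _))// (natrD _ 1 1) lerD.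
have mgB v n : measurable_fun setT (fun u => g n u - g n v).
  by apply: measurable_funB => //; have [] := Fg n.
have hv v : asymp_le (h ^~ v) 0.
  have := asymp_le_Rintegral nu1T (mgB v) (g2 v) measurableT
    (fun u _ => merge Ff u v) (fun u _ => merge Ff u v).
  by rewrite subrr mul0r subr0.
have mhn n : measurable_fun setT (h n).
  rewrite (_ : h n = fun v => \int[nu1]_u g n u - g n v); last exact/funext.
  by apply: measurable_funB => //; have [] := Fg n.
have h2 n v : `|h n v| <= 2 by exact: normr_Rintegral_le.
have := asymp_le_Rintegral nu2T mhn h2 measurableT (fun v _ => hv v)
  (fun v _ => hv v).
rewrite subrr mul0r subr0; congr (asymp_le _ _); apply/funext => n.
under eq_Rintegral do rewrite hE.
rewrite (@RintegralB_bounded _ _ _ _ nu2T _ _ 1)//.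
- by rewrite Rintegral_unit_cst.
- by have [] := Fg n.
- by move=> _; apply: normr_Rintegral_le => //; have [] := Fg n.
- by have [] := Fg n.
Qed.

(** Uniformity in [f] comes from the quantification over sequences: if every integer time had a bad
    test function, these would form a forbidden sequence. Later times follow because
    [Ptf (t - N%:R)] preserves the unit ball. *)
Lemma merging_measures (e : R) : 0 < e -> exists N : nat, forall t, N%:R <= t ->
  forall f, unit_ball f -> `|\int[nu1]_x Ptf t f x - \int[nu2]_x Ptf t f x| <= e.
Proof.
move=> e0.
have [N HN] : exists N : nat, forall f, unit_ball f ->
    `|\int[nu1]_x Ptf N%:R f x - \int[nu2]_x Ptf N%:R f x| <= e.
  apply: contrapT => /forallNP H.
  have {}H (n : nat) : exists f, unit_ball f /\
      ~ `|\int[nu1]_x Ptf n%:R f x - \int[nu2]_x Ptf n%:R f x| <= e.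
    by have /existsNP[f /not_implyP[Ff Hf]] := H n; exists f.
  have [f Hf] := choice H.
  have [N _ /(_ N)] := merging_measures_seq (fun n => (Hf n).1) e0.
  by rewrite add0r => /(_ (leqnn N)); exact: (Hf N).2.
exists N => t Nt f Ff.
have -> : Ptf t f = Ptf N%:R (Ptf (t - N%:R) f).
  by apply/funext => x; rewrite -{1}(subrKC N%:R t) PtfD// subr_ge0.
by apply: HN; exact: unit_ball_Ptf.
Qed.

End merging_measures.
End merging.

(** * Countably additive part of an ultralimit *)

(** The compact interval provides a cluster point, and an ultrafilter converges to each of its
    cluster points. *)
Lemma ultra_cvg_bounded (R : realType) (I : Type) (U : set_system I)
    (u : I -> R) (a b : R) : UltraFilter U -> (forall i, a <= u i <= b) ->
  cvg (u i @[i --> U]).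
Proof.
move=> UU uab; have [|p [_ up]] := @segment_compact R a b (u @ U) _.
  by apply: nearW => i; rewrite /= in_itv/=; exact: uab.
apply/cvg_ex; exists p => V pV.
have [//|UV] := in_ultra_setVsetC (u @^-1` V) UU.
have [q [/= NVq Vq]] := up (~` V) V UV pV.
by [].
Qed.

(* The largest measure dominated by a finitely additive content. *)
Section countably_additive_part.
Context d (T : measurableType d) (R : realType).
Variable L : {content set T -> \bar R}.
Local Open Scope ereal_scope.

Definition ca_part : set T -> \bar R := mu_ext L.

(** Cutting the sets of a cover of [X] along [A] gives covers of the two pieces of [X]; adding up
    the cut sets takes only finite additivity of [L]. *)
Let ca_part_caratheodory A : measurable A -> caratheodory_measurable ca_part A.
Proof.
move=> mA; apply: (@le_caratheodory_measurable R T (mu_ext L)) => X.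
apply: le_ereal_inf_tmp => _ [F [mF XF] <-].
apply: (@le_trans _ _
    (\sum_(k <oo) L (F k `&` A) + \sum_(k <oo) L (F k `&` ~` A))).
  apply: leeD; apply: ereal_inf_lbound.
  - exists (fun k => F k `&` A) => //; split.
      by move=> i; exact: measurableI.
    by move=> x [/XF[k _ Fkx] Ax]; exists k.
  - exists (fun k => F k `&` ~` A) => //; split.
      by move=> i; apply: measurableI => //; exact: measurableC.
    by move=> x [/XF[k _ Fkx] Ax]; exists k.
rewrite -nneseriesD//; apply: lee_nneseries => [i _ _|i _].
  by rewrite adde_ge0.
have mI : measurable (F i `&` A) by exact: measurableI.
have mIC : measurable (F i `&` ~` A).
  by apply: measurableI => //; exact: measurableC.
have IC0 : F i `&` A `&` (F i `&` ~` A) = set0 by rewrite setIACA setICr setI0.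
have := measureU L mI mIC IC0.
by rewrite -setIUr setUCr setIT => ->.
Qed.

Let ca_part0 : ca_part set0 = 0.
Proof. exact: (@outer_measure0 R T (mu_ext L)). Qed.

Let ca_part_ge0 A : 0 <= ca_part A.
Proof. exact: (@outer_measure_ge0 R T (mu_ext L)). Qed.

Let ca_part_sigma_additive : semi_sigma_additive ca_part.
Proof.
move=> F mF tF mUF.
apply: (@caratheodory_measure_sigma_additive R T (mu_ext L) F) => //.
- by move=> i; exact: ca_part_caratheodory.
- exact: ca_part_caratheodory.
Qed.

HB.instance Definition _ := isMeasure.Build _ _ _ ca_part
  ca_part0 ca_part_ge0 ca_part_sigma_additive.

Lemma ca_part_le A : measurable A -> ca_part A <= L A.
Proof.
move=> mA; apply: ereal_inf_lbound.
exists (fun k => if k is 0%N then A else set0).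
  by split; [case|move=> x Ax; exists 0%N].
rewrite (nneseries_split _ 1%N)// big_nat1 eseries0 ?adde0//.
by case=> // n _ _; rewrite measure0.
Qed.

(** Maximality: countable subadditivity bounds [m A] by the sum of [L] over any measurable cover of
    [A]. *)
Lemma le_ca_part (m : {measure set T -> \bar R}) :
  (forall A, measurable A -> m A <= L A) ->
  forall A, measurable A -> m A <= ca_part A.
Proof.
move=> mL A mA; apply: le_ereal_inf_tmp => _ [F [mF AF] <-].
apply: (le_trans (measure_sigma_subadditive m mF mA AF)).
by apply: lee_nneseries => // i _; exact: mL.
Qed.

(** The finite unions [G n] of a countable cover increase to the whole space, so [lam (G n)] tends
    to 1, while [L (G n)] stays below the sum over the cover. Countable additivity is thus borrowed
    from [lam], since [L] itself is only finitely additive. *)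
Lemma ca_part_setT_ge (lam : {measure set T -> \bar R}) (c eps : R) :
  lam setT = 1 -> (0 <= c)%R ->
  (forall E, measurable E -> (c * (fine (lam E) - eps))%:E <= L E) ->
  (c * (1 - eps))%:E <= ca_part setT.
Proof.
move=> lam1 c0 HL; apply: le_ereal_inf_tmp => _ [F [mF TF] <-].
pose G n := \big[setU/set0]_(i < n) F i.
have mG n : measurable (G n) by exact: bigsetU_measurable.
have ubound n : (c * (fine (lam (G n)) - eps))%:E <= \sum_(k <oo) L (F k).
  apply: (le_trans (HL _ (mG n))).
  apply: (@le_trans _ _ (\sum_(i < n) L (F i))).
    elim: n => [|n IHn]; first by rewrite /G !big_ord0 measure0.
    rewrite /G !big_ord_recr/=; apply: le_trans (leeD2r _ IHn).
    (* The new set is made disjoint from [G n], so that additivity of [L] applies. *)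
    have -> : G n `|` F n = G n `|` (F n `\` G n) by rewrite setUDr setDv setD0.
    have mD : measurable (F n `\` G n) by exact: measurableD.
    have D0 : G n `&` (F n `\` G n) = set0 by rewrite setDE setICA setICr setI0.
    have := measureU L (mG n) mD D0; rewrite -/(G n) => ->.
    by apply: leeD2l; apply: le_measure; rewrite ?inE.
  rewrite -(big_mkord xpredT (fun i => L (F i))).
  exact: nneseries_lim_ge.
have GT : \bigcup_n G n = setT.
  apply/seteqP; split => // x _; have [k _ Fkx] := TF x I.
  by exists k.+1 => //; rewrite /G big_ord_recr/=; right.
have ndG : nondecreasing_seq G.
  by apply/nondecreasing_seqP => n; rewrite /G big_ord_recr/=; apply/subsetPset => x; left.
have cv : lam (G n) @[n --> \oo] --> 1.
  rewrite -lam1 -GT; apply: nondecreasing_cvg_mu => //.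
  exact: bigcupT_measurable.
have cvf : ((c * (fine (lam (G n)) - eps))%:E @[n --> \oo] --> (c * (1 - eps))%:E).
  apply: cvg_EFin; first exact: nearW.
  apply: cvgM; first exact: cvg_cst.
  apply: cvgB; last exact: cvg_cst.
  exact: (fine_cvg cv).
have := cvg_lim _ cvf => <- //.
apply: lime_le; first by apply/cvg_ex; eexists; exact: cvf.
exact: nearW.
Qed.

End countably_additive_part.

(** * Ultralimits of measures of mass 1 *)

Section ultralimit.
Context d (T : measurableType d) (R : realType) (U : set_system nat).
Hypothesis UU : UltraFilter U.
Variable nu : nat -> {measure set T -> \bar R}.
Hypothesis nu1 : forall n, nu n setT = 1%E.

(* The value 0 on non-measurable sets is a dummy one. *)
Definition ultralimit of UltraFilter U & (forall n, nu n setT = 1%E) :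
    set T -> \bar R := fun A =>
  if `[< measurable A >] then (lim (fine (nu n A) @[n --> U]))%:E else 0%E.

Let L := ultralimit UU nu1.

Lemma ultralimit_cvg A : measurable A ->
  fine (nu n A) @[n --> U] --> lim (fine (nu n A) @[n --> U]).
Proof.
move=> mA; apply: (ultra_cvg_bounded UU (a := 0) (b := 1)) => n.
exact: unit_mass_fine_le1.
Qed.

Lemma ultralimitE A (l : R) : measurable A ->
  fine (nu n A) @[n --> U] --> l -> L A = l%:E.
Proof.
move=> mA nul; rewrite /L /ultralimit; case: asboolP => // _; congr EFin.
exact: cvg_lim.
Qed.

Let ultralimit0 : L set0 = 0%E.
Proof.
apply: ultralimitE => //; rewrite (_ : (fun n => _) = cst 0).
  exact: cvg_cst.
by apply/funext => n; rewrite measure0.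
Qed.

Let ultralimit_ge0 A : (0 <= L A)%E.
Proof.
rewrite /L /ultralimit; case: asboolP => // mA; rewrite lee_fin.
apply: limr_ge; first by apply/cvg_ex; eexists; exact: ultralimit_cvg.
by apply: nearW => n; exact: fine_ge0.
Qed.

Let ultralimit_additive : measure_function.semi_additive L.
Proof.
apply/additive2P; first exact: ultralimit0.
move=> A B mA mB AB.
rewrite (ultralimitE mA (ultralimit_cvg mA)) (ultralimitE mB (ultralimit_cvg mB)).
rewrite -EFinD; apply: ultralimitE; first exact: measurableU.
rewrite (_ : (fun n => _) = (fun n => fine (nu n A) + fine (nu n B))).
  by apply: cvgD; exact: ultralimit_cvg.
apply/funext => n; rewrite measureU// fineD//; exact: unit_mass_fin_num.
Qed.

HB.instance Definition _ := isContent.Build _ T R (ultralimit UU nu1)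
  ultralimit_ge0 ultralimit_additive.

End ultralimit.

Lemma measurable_superlevel d (T : measurableType d) (R : realType) (g : T -> R)
  (a : R) : measurable_fun setT g -> measurable [set x | a <= g x].
Proof.
move=> mg; have := mg measurableT `[a, +oo[%classic (measurable_itv _).
rewrite setTI; congr measurable; apply/seteqP.
by split=> x /=; rewrite in_itv/= andbT.
Qed.

(** * Discrete layer-cake estimates *)

Section layer_cake.
Context d (T : measurableType d) (R : realType).
Implicit Type Q : {measure set T -> \bar R}.

(** The sum counts the positive integers up to [m] that are at most [y]. It is thus a lower
    approximation of [y], within 1 as long as [y <= m%:R]. *)
Lemma sum_layers_le (m : nat) (y : R) : 0 <= y ->
  \sum_(k < m) (k.+1%:R <= y)%R%:R <= y.
Proof.
move=> y0; elim: m => [|m IHm]; first by rewrite big_ord0.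
rewrite big_ord_recr/=; have [my|my] := leP m.+1%:R y; last by rewrite addr0.
apply: le_trans my; rewrite -natr1 lerD2r.
rewrite -[leRHS](_ : \sum_(k < m) 1 = m%:R); last by rewrite big_const_ord iter_addr_0.
by apply: ler_sum => k _; rewrite lern1 leq_b1.
Qed.

Lemma sum_layers_ge (m : nat) (y : R) : y <= m%:R ->
  y <= \sum_(k < m) (k.+1%:R <= y)%R%:R + 1.
Proof.
elim: m => [|m IHm] ym; first by rewrite big_ord0 add0r (le_trans ym).
rewrite big_ord_recr/=; have [my|/ltW my] := leP y m%:R.
  by rewrite (le_trans (IHm my))// lerD2r lerDl.
have -> : \sum_(k < m) (k.+1%:R <= y)%R%:R = m%:R :> R.
  transitivity (\sum_(k < m) (1 : R)); last by rewrite big_const_ord iter_addr_0.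
  by apply: eq_bigr => k _; rewrite (le_trans _ my)// ler_nat.
by rewrite addrAC natr1 (le_trans ym)// lerDl.
Qed.

Lemma Rintegral_sum_indic Q (E : nat -> set T) (m : nat) : Q setT = 1%E ->
  (forall k, measurable (E k)) ->
  [/\ measurable_fun setT (fun x => \sum_(k < m) \1_(E k) x : R),
      forall x, `|\sum_(k < m) \1_(E k) x : R| <= m%:R &
      \int[Q]_x (\sum_(k < m) \1_(E k) x) = \sum_(k < m) fine (Q (E k))].
Proof.
move=> Q1 mE; elim: m => [|m [mS bS iS]].
  split.
  - under eq_fun do rewrite big_ord0.
    exact: measurable_cst.
  - by move=> x; rewrite big_ord0 normr0.
  - under eq_Rintegral do rewrite big_ord0.
    by rewrite Rintegral_unit_cst// big_ord0.
have mI : measurable_fun setT (\1_(E m) : T -> R) by exact: measurable_indic.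
split.
- under eq_fun do rewrite big_ord_recr/=.
  exact: measurable_funD.
- move=> x; rewrite big_ord_recr/= -natr1 (le_trans (ler_normD _ _))// lerD//.
  exact: normr_indic_le1.
- under eq_Rintegral do rewrite big_ord_recr/=.
  rewrite (@RintegralD_bounded _ _ _ _ Q1 _ _ m.+1%:R)//.
  + by rewrite iS Rintegral_indic// big_ord_recr.
  + by move=> x; rewrite (le_trans (bS x))// ler_nat.
  + by move=> x; rewrite (le_trans (normr_indic_le1 _ _ _))// ler1n.
Qed.

(** The function [m.+1%:R * f] is within 1 of the sum of the indicators of its superlevel sets, so
    inequalities on [m.+1] sets give one between integrals, at the cost of [m.+1%:R^-1]. Only
    finitely many sets occur, so one measure [Q2] can approximate a content on all of them. *)
Lemma le_Rintegral_layers Q1 Q2 (f : T -> R) (m : nat) (a e : R) :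
  Q1 setT = 1%E -> Q2 setT = 1%E -> measurable_fun setT f ->
  (forall x, 0 <= f x <= 1) -> 0 <= a <= 1 ->
  (forall k : nat, let E := [set x | k.+1%:R <= m.+1%:R * f x] in
    (k < m.+1)%N -> a * fine (Q1 E) <= fine (Q2 E) + e) ->
  a * \int[Q1]_x f x <= \int[Q2]_x f x + e + m.+1%:R^-1.
Proof.
move=> Q11 Q21 mf f01 /andP[a0 a1] HE.
pose E k := [set x | k.+1%:R <= m.+1%:R * f x].
have mE k : measurable (E k).
  apply: measurable_superlevel.
  exact: measurable_funM.
pose S x : R := \sum_(k < m.+1) \1_(E k) x.
have SE x : S x = \sum_(k < m.+1) (k.+1%:R <= m.+1%:R * f x)%R%:R.
  by apply: eq_bigr => k _; rewrite indicE; congr (nat_of_bool _)%:R; apply/idP/idP; rewrite inE.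
have [mS bS i1] := Rintegral_sum_indic m.+1 Q11 mE.
have [_ _ i2] := Rintegral_sum_indic m.+1 Q21 mE.
have mf0 x : 0 <= m.+1%:R * f x.
  by rewrite mulr_ge0//; have /andP[] := f01 x.
have mfm x : m.+1%:R * f x <= m.+1%:R.
  by rewrite ler_piMr//; have /andP[] := f01 x.
have f1 x : `|f x| <= 1.
  by have /andP[? ?] := f01 x; rewrite ger0_norm.
have mmf : measurable_fun setT (fun x => m.+1%:R * f x) by exact: measurable_funM.
have bmf x : `|m.+1%:R * f x| <= m.+2%:R.
  by rewrite ger0_norm// (le_trans (mfm x))// ler_nat.
have bS2 x : `|S x| <= m.+2%:R by rewrite (le_trans (bS x))// ler_nat.
have iZ (Q : {measure set T -> \bar R}) : Q setT = 1%E ->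
    \int[Q]_x (m.+1%:R * f x) = m.+1%:R * \int[Q]_x f x.
  by move=> QT; rewrite RintegralZl//; exact: bounded_integrable f1.
have H1 : m.+1%:R * \int[Q1]_x f x <= \sum_(k < m.+1) fine (Q1 (E k)) + 1.
  rewrite -iZ// -i1 -[X in _ <= _ + X](Rintegral_unit_cst Q11).
  rewrite -(@RintegralD_bounded _ _ _ _ Q11 _ _ m.+1%:R)//; last first.
    by move=> _; rewrite normr1 ler1n.
  apply: (@le_Rintegral_bounded _ _ _ _ Q11 _ _ m.+2%:R) => //.
  - exact: measurable_funD.
  - move=> x; apply: (le_trans (ler_normD _ _)).
    by rewrite normr1 -(natr1 m.+1) lerD2r; exact: bS.
  - by move=> x; rewrite -/(S x) SE sum_layers_ge.
have H2 : \sum_(k < m.+1) fine (Q2 (E k)) <= m.+1%:R * \int[Q2]_x f x.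
  rewrite -iZ// -i2; apply: (@le_Rintegral_bounded _ _ _ _ Q21 _ _ m.+2%:R) => //.
  by move=> x; rewrite -/(S x) SE sum_layers_le.
have H3 : a * \sum_(k < m.+1) fine (Q1 (E k)) <=
    \sum_(k < m.+1) fine (Q2 (E k)) + m.+1%:R * e.
  have -> : m.+1%:R * e = \sum_(k < m.+1) e by rewrite sumr_const card_ord mulr_natl.
  by rewrite mulr_sumr -big_split/=; apply: ler_sum => k _; exact: HE.
rewrite -(ler_pM2l (ltr0Sn R m)) 2!mulrDr divff ?pnatr_eq0//.
apply: (le_trans (y := a * (\sum_(k < m.+1) fine (Q1 (E k)) + 1))).
  by rewrite mulrCA ler_wpM2l.
by rewrite mulrDr mulr1 lerD// (le_trans H3)// lerD2r.
Qed.

End layer_cake.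

(** The inequality on the complement is the reverse inequality on the set. *)
Lemma unit_mass_le_eq d (T : measurableType d) (R : realType)
    (m1 m2 : {measure set T -> \bar R}) :
  m1 setT = 1%E -> m2 setT = 1%E ->
  (forall A, measurable A -> fine (m1 A) <= fine (m2 A)) ->
  forall A, measurable A -> m1 A = m2 A.
Proof.
move=> m11 m21 m12 A mA.
have mCA : measurable (~` A) by exact: measurableC.
have E (m : {measure set T -> \bar R}) : m setT = 1%E ->
    fine (m A) = 1 - fine (m (~` A)).
  move=> m1T; have : (m setT = m A + m (~` A))%E.
    by rewrite -(setUCr A); apply: measureU => //; rewrite setICr.
  rewrite m1T => /(congr1 fine); rewrite fineD; [|exact: unit_mass_fin_num..].
  by move=> /= ->; rewrite addrK.
rewrite -(fineK (unit_mass_fin_num m11 mA)) -(fineK (unit_mass_fin_num m21 mA)).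
congr EFin; apply/le_anti; rewrite m12//= (E m1)// (E m2)//.
by rewrite lerB// m12.
Qed.

(** * Invariance of the countably additive part *)

Section invariant_of_ultralimit.
Context d (T : measurableType d) (R : realType) (I : Type).
Variables (nu : nat -> {measure set T -> \bar R}) (lam : {measure set T -> \bar R}).
Variables (k : I -> R.-pker T ~> T) (c eps : R).
Hypothesis nu1 : forall n, nu n setT = 1%E.
Hypothesis lam1 : lam setT = 1%E.
Hypothesis asymp_invariant : forall i A, measurable A -> forall e : R, 0 < e ->
  \forall n \near \oo, fine (pushK (k i) (nu n) A) <= fine (nu n A) + e.
Hypotheses (c0 : 0 < c) (eps1 : eps < 1).
Hypothesis minorized : forall E, measurable E ->
  \forall n \near \oo, c * (fine (lam E) - eps) <= fine (nu n E).

(** The candidate is the normalized countably additive part of an ultralimit [L]. Its image under a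
    kernel, rescaled by [m0], is a measure below [L], hence below the countably additive part by
    maximality; equality follows since the masses agree. *)
Lemma exists_invariant_probability : exists mu : probability T R,
  forall i A, measurable A -> pushK (k i) mu A = mu A.
Proof.
have [U [UU ooU]] := ultraFilterLemma (eventually_filter : ProperFilter \oo).
pose L : {content set T -> \bar R} := ultralimit UU nu1.
have LE A : measurable A -> L A = (lim (fine (nu n A) @[n --> U]))%:E.
  by move=> mA; exact: ultralimitE mA (ultralimit_cvg UU nu1 mA).
have LT : L setT = 1%E.
  apply: ultralimitE => //; rewrite (_ : (fun n => _) = cst 1).
    exact: cvg_cst.
  by apply/funext => n; rewrite nu1.
pose mu : {measure set T -> \bar R} := ca_part L.
have muL A : measurable A -> (mu A <= L A)%E by exact: ca_part_le.
have mufin A : measurable A -> mu A \is a fin_num.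
  by move=> mA; rewrite ge0_fin_numE// (le_lt_trans (muL _ mA))// LE// ltry.
have mugt0 : (0 < mu setT)%E.
  apply: (@lt_le_trans _ _ (c * (1 - eps))%:E).
    by rewrite lte_fin mulr_gt0// subr_gt0.
  apply: ca_part_setT_ge lam1 (ltW c0) _ => E mE; rewrite LE// lee_fin.
  apply: limr_ge; first by apply/cvg_ex; eexists; exact: ultralimit_cvg.
  exact: ooU (minorized mE).
pose m0 := fine (mu setT).
have m0gt0 : 0 < m0 by rewrite -lte_fin fineK// mufin.
have m01 : m0 <= 1 by rewrite -lee_fin fineK ?mufin// -LT muL.
(* The Dirac mass is the default value of [mnormalize] for mass 0 or infinite mass, both excluded
   here. *)
pose q : probability T R := mnormalize mu \d_(point : T).
have qE A : measurable A -> m0 * fine (q A) = fine (mu A).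
  move=> mA; rewrite /q /= /mnormalize ifF; last first.
    apply/negbTE; rewrite negb_or gt_eqF//=.
    by have := mufin _ measurableT; rewrite fin_numE => /andP[].
  by rewrite -[mu A]fineK ?mufin//= mulrC divfK ?gt_eqF.
exists q => i.
have q1 : q setT = 1%E by exact: probability_setT.
have pq1 := pushK_setT (k i) q1.
apply: unit_mass_le_eq => // A mA.
rewrite -(ler_pM2l m0gt0) qE//.
pose r : {nonneg R} := NngNum (ltW m0gt0).
have : ((mscale r (pushK (k i) q)) A <= mu A)%E.
  apply: le_ca_part mA => {}A mA.
  change (m0%:E * pushK (k i) q A <= L A)%E.
  rewrite LE// -(fineK (unit_mass_fin_num pq1 mA)) -EFinM lee_fin.
  have mI : measurable_fun setT (\1_A : T -> R) by exact: measurable_indic.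
  (* [f x] is the mass of [A] under [k i x], so pushing a measure and evaluating at [A] amounts to
     integrating [f]. *)
  pose f x := \int[k i x]_y \1_A y : R.
  have fE (Q : {measure set T -> \bar R}) : Q setT = 1%E ->
      fine (pushK (k i) Q A) = \int[Q]_x f x.
    move=> Q1; rewrite -Rintegral_indic// (Rintegral_pushK _ _ mI (M := 1))//.
    exact: normr_indic_le1.
  have mf : measurable_fun setT f.
    exact: (measurable_fun_Rintegral_kernel _ mI (@normr_indic_le1 _ _ _ A)).
  have f01 x : 0 <= f x <= 1.
    by rewrite /f Rintegral_indic// unit_mass_fine_le1// prob_kernel.
  rewrite fE//; apply/ler_addgt0Pr => e e0.
  have e40 : 0 < e / 4 by rewrite divr_gt0.
  have [m _ /(_ m (leqnn m))] := near_infty_natSinv_lt (PosNum e40).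
  rewrite /= => me.
  pose E j := [set x | j.+1%:R <= m.+1%:R * f x].
  have mE j : measurable (E j).
    apply: measurable_superlevel.
    exact: measurable_funM.
  have nearL B : measurable B -> \forall n \near U,
      `|lim (fine (nu n B) @[n --> U]) - fine (nu n B)| <= e / 4.
    move=> mB; have := ultralimit_cvg UU nu1 mB.
    by move/cvgrPdist_le => /(_ _ e40).
  (* A single index [n] serves for all level sets of [f] and for [A]. The four errors, each at most
     [e / 4], come from the levels, the discretization, asymptotic invariance and the limit at
     [A]. *)
  have : \forall n \near U, [/\ forall j : 'I_m.+1,
      `|lim (fine (nu n (E j)) @[n --> U]) - fine (nu n (E j))| <= e / 4,
      `|lim (fine (nu n A) @[n --> U]) - fine (nu n A)| <= e / 4 &
      fine (pushK (k i) (nu n) A) <= fine (nu n A) + e / 4].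
    have H1 : \forall n \near U, forall j : 'I_m.+1,
        `|lim (fine (nu n (E j)) @[n --> U]) - fine (nu n (E j))| <= e / 4.
      by apply: filter_forall => j; exact: nearL.
    have H2 := nearL _ mA.
    have H3 := ooU _ (asymp_invariant i mA e40).
    by apply: filterS3 H1 H2 H3 => n.
  move=> /filter_ex[n [HE HA Hp]].
  have := @le_Rintegral_layers _ _ _ q (nu n) f m m0 (e / 4) q1 (nu1 n) mf f01.
  rewrite (ltW m0gt0) m01 => /(_ isT) HH.
  apply: (le_trans (HH _)).
    move=> j /= jm; rewrite (qE _ (mE j)).
    apply: (@le_trans _ _ (lim (fine (nu n (E j)) @[n --> U]))).
      by rewrite -lee_fin fineK ?mufin// -LE// muL.
    by have := HE (Ordinal jm); rewrite ler_norml => /andP[_]; rewrite lerBlDl.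
  rewrite -fE//; move: HA Hp me; rewrite ler_norml => /andP[].
  by move: (lim _) (fine _) (fine _) (m.+1%:R^-1) => l p s t; lra.
change ((m0%:E * pushK (k i) q A <= mu A)%E ->
  m0 * fine (pushK (k i) q A) <= fine (mu A)).
by rewrite -(fineK (unit_mass_fin_num pq1 mA)) -{1}(fineK (mufin _ mA)).
Qed.

End invariant_of_ultralimit.

(** * Borel measures on Polish spaces *)

Section metric_balls.
Context (R : realType) (X : pseudoMetricType R) (rho : X -> X -> R).
Hypothesis Hrho : is_metric_of rho.

Lemma metric_ballE x r : ball x r = [set y | rho x y < r].
Proof. by case: Hrho. Qed.

Lemma metric_ball_open (x : X) r : open (ball x r).
Proof.
have [_ _ _ tri _] := Hrho.
rewrite openE => y; rewrite metric_ballE/= => xyr.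
apply/nbhs_ballP; exists (r - rho x y) => /=; first by rewrite subr_gt0.
move=> u; rewrite !metric_ballE/= ltrBrDl; exact: le_lt_trans.
Qed.

Lemma metric_continuous (x : X) : continuous (rho x).
Proof.
have [_ _ sym tri _] := Hrho.
move=> y; apply/cvgrPdist_lt => e e0; apply/nbhs_ballP; exists e => //= u.
rewrite metric_ballE/= => yu; rewrite ltr_norml.
have := tri x y u; have := tri x u y; rewrite (sym u y).
by move: (rho x u) (rho x y) (rho y u) yu => p q s; lra.
Qed.

End metric_balls.

Section borel.
Context (R : realType) (X : completePseudoMetricType R).
Notation B := (BorelSpace X).

Lemma open_borel (O : set X) : open O -> measurable (O : set B).
Proof. by move=> oO; exact: sub_sigma_algebra. Qed.

Lemma closed_borel (F : set X) : closed F -> measurable (F : set B).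
Proof.
move=> cF; rewrite -[F]setCK; apply: measurableC; apply: open_borel.
exact: closed_openC.
Qed.

Lemma continuous_borel (f : X -> R) : continuous f ->
  measurable_fun [set: B] (f : B -> R).
Proof.
move=> /continuousP cf; apply: (measurability _ (RGenOpens.measurableE R)).
move=> _ [_ [a [b ->] <-]]; rewrite setTI; apply: open_borel; apply: cf.
exact: interval_open.
Qed.

Lemma closed_open_separation (K O : set X) : closed K -> open O -> K `<=` O ->
  exists f : X -> R, [/\ continuous f, forall x, 0 <= f x <= 1,
    forall x, K x -> f x = 1 & forall x, ~ O x -> f x = 0].
Proof.
move=> cK oO KO.
have D0 : ~` O `&` K = set0 by rewrite setIC; apply/disjoints_subset; rewrite setCK.
have [f [cf f0 f1 rf]] := urysohn_ext_itv (@pseudometric_normal R X)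
  (open_closedC oO) cK D0 (@ltr01 R).
exists f; split => //.
- by move=> x; have := rf (f x); rewrite /= in_itv/=; apply; exists x.
- by move=> x Kx; apply: f1; exists x.
- by move=> x Ox; apply: f0; exists x.
Qed.

End borel.

(** * Points charged at every radius *)

Section support.
Context (R : realType) (X : completePseudoMetricType R) (rho : X -> X -> R).
Hypotheses (Hrho : is_metric_of rho) (Hsep : separable_space X).
Notation B := (BorelSpace X).

(** Otherwise every point of [O] has a null ball around it, which contains a null ball centered in
    the countable dense set, of radius the inverse of an integer, still containing the point.
    Countably many null balls would cover [O]. *)
Lemma exists_charged_point (nu : {measure set B -> \bar R}) (O : set X) :
  open O -> (0 < nu (O : set B))%E ->
  exists2 y, O y & forall r, 0 < r -> (0 < nu (ball y r : set B))%E.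
Proof.
move=> oO nuO; apply: contrapT => H.
have {}H y : O y -> exists2 r, 0 < r & nu (ball y r : set B) = 0%E.
  move=> Oy; apply: contrapT => Hy; apply: H; exists y => // r r0.
  rewrite lt_neqAle measure_ge0 andbT; apply/eqP => /esym nu0.
  by apply: Hy; exists r.
have [D [cD dD]] := Hsep.
have /countable_injP[g gD] := cD.
(* [u] lists the points of [D], with a default value at indices outside the range of [g]. *)
pose u i := xget (point : X) [set y | D y /\ g y = i].
have uD y : D y -> u (g y) = y.
  move=> Dy; rewrite /u; case: xgetP => [v _ [Dv gvy]|/(_ y)[]//].
  by apply: gD => //; rewrite inE.
pose V (i j : nat) : set B := if nu (ball (u i) j.+1%:R^-1 : set B) == 0%E
  then ball (u i) j.+1%:R^-1 else set0.
have V0 i j : nu.-negligible (V i j).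
  rewrite /V; case: eqP => [H0|_]; last exact: negligible_set0.
  by apply/negligibleP => //; apply: open_borel; exact: metric_ball_open Hrho _ _.
have : nu.-negligible (O : set B).
  have nV : nu.-negligible (\bigcup_i \bigcup_j V i j).
    by apply: negligible_bigcup => i; exact: negligible_bigcup.
  apply: negligibleS nV.
  move=> y /H[r r0 nur].
  have r20 : 0 < r / 2 by rewrite divr_gt0.
  have [j _ /(_ j (leqnn j))] := near_infty_natSinv_lt (PosNum r20).
  rewrite /= => jr.
  have [d [yd Dd]] : ball y j.+1%:R^-1 `&` D !=set0.
    apply: dD; last exact: metric_ball_open Hrho _ _.
    by exists y; apply: ballxx; rewrite invr_gt0.
  have dsub : ball d j.+1%:R^-1 `<=` ball y r.
    move=> v dv; apply: (@le_ball _ _ _ (j.+1%:R^-1 + j.+1%:R^-1)).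
      by rewrite (splitr r) lerD// ltW.
    exact: ball_triangle yd dv.
  exists (g d) => //; exists j => //; rewrite /V uD// ifT; last first.
    rewrite eq_le measure_ge0 andbT -nur; apply: le_measure => //; rewrite inE;
      by apply: open_borel; exact: metric_ball_open Hrho _ _.
  exact: ball_sym.
move=> /negligibleP => /(_ (open_borel oO)) nuO0.
by rewrite nuO0 ltxx in nuO.
Qed.

End support.

(** * Regularity of Borel measures of mass 1 *)

Section regularity.
Context (R : realType) (X : completePseudoMetricType R) (rho : X -> X -> R).
Hypothesis Hrho : is_metric_of rho.
Notation B := (BorelSpace X).
Variable nu : {measure set B -> \bar R}.
Hypothesis nu1 : nu setT = 1%E.

Let regular (E : set B) := forall e : R, 0 < e -> exists K O : set X,
  [/\ closed K, open O, K `<=` E, E `<=` O & (nu (O `\` K : set B) <= e%:E)%E].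

(** A closed set is its own inner approximation and the decreasing intersection of its open
    neighborhoods [G n]. *)
Let regular_closed (F : set X) : closed F -> regular F.
Proof.
move=> cF e e0.
pose G (n : nat) : set B := \bigcup_(x in F) ball x n.+1%:R^-1.
have oG n : open (G n : set X).
  by apply: bigcup_open => x _; exact: metric_ball_open Hrho _ _.
have FG n : F `<=` G n by move=> x Fx; exists x => //; exact: ballxx.
have mF : measurable (F : set B) by exact: closed_borel.
have GF : \bigcap_n (G n `\` F) = set0.
  apply/seteqP; split => // x Gx; have [_ nFx] := Gx 0 I.
  apply: nFx; apply: cF => V /nbhs_ballP[r /= r0 rV].
  have [j _ /(_ j (leqnn j))] := near_infty_natSinv_lt (PosNum r0).
  rewrite /= => jr.
  have [[y Fy yx] _] := Gx j I; exists y; split => //; apply: rV.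
  by apply: (le_ball (ltW jr)); exact: ball_sym.
have mGF n : measurable (G n `\` F) by apply: measurableD => //; exact: open_borel.
have ndG : nonincreasing_seq (fun n => G n `\` F).
  move=> m n mn; apply/subsetPset => x [[y Fy yx] nFx]; split => //; exists y => //.
  by apply: le_ball yx; rewrite lef_pV2 ?posrE// ler_nat.
have lty n : (nu (G n `\` F) < +oo)%E by rewrite ltey_eq unit_mass_fin_num.
have mGF0 : measurable (\bigcap_n (G n `\` F)) by rewrite GF.
have := @nonincreasing_cvg_mu _ _ _ nu (fun n => G n `\` F) (lty 0) mGF mGF0 ndG.
rewrite GF measure0 => cv.
have {}cv : fine (nu (G n `\` F)) @[n --> \oo] --> (0 : R) by exact: (fine_cvg cv).
move/cvgrPdist_le : cv => /(_ e e0)[n _ /(_ n (leqnn n))].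
rewrite sub0r normrN ger0_norm ?fine_ge0// => Ge.
exists F, (G n); split => //.
by rewrite -lee_fin fineK ?unit_mass_fin_num in Ge.
Qed.

Let regular_setC (E : set B) : regular E -> regular (~` E).
Proof.
move=> rE e e0; have [K [W [cK oO KE EO nuOK]]] := rE e e0.
exists (~` W), (~` K); split.
- exact: open_closedC.
- exact: closed_openC.
- exact: subsetC.
- exact: subsetC.
- by rewrite setDE setCK setIC -setDE.
Qed.

(** Half of [e] pays for approximating the sets [E n], the other half for keeping finitely many
    inner sets, whose union is then closed. *)
Let regular_bigcup (E : nat -> set B) : (forall n, regular (E n)) ->
  regular (\bigcup_n E n).
Proof.
move=> rE e e0.
have e20 : 0 < e / 2 by rewrite divr_gt0.
have /choice[KO HKO] : forall n, exists KO : set X * set X,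
    [/\ closed KO.1, open KO.2, KO.1 `<=` E n, E n `<=` KO.2 &
    (nu (KO.2 `\` KO.1 : set B) <= (e / 2 / (2 ^ n.+1)%:R)%:E)%E].
  move=> n; have [|K [W H]] := rE n (e / 2 / (2 ^ n.+1)%:R).
    by rewrite divr_gt0// ltr0n expn_gt0.
  by exists (K, W).
pose K n : set B := (KO n).1; pose O : set B := \bigcup_n (KO n).2.
have cK n : closed (K n : set X) by have [] := HKO n.
have mK n : measurable (K n) by exact: closed_borel.
have mOn n : measurable ((KO n).2 : set B) by apply: open_borel; have [] := HKO n.
have oO : open (O : set X) by apply: bigcup_open => n _; have [] := HKO n.
have mO : measurable O by exact: open_borel.
pose G n : set B := O `\` \big[setU/set0]_(i < n) K i.
have mG n : measurable (G n).
  by apply: measurableD => //; exact: bigsetU_measurable.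
have GE : \bigcap_n G n = O `\` \bigcup_n K n.
  apply/seteqP; split => [x Gx|x [Ox nKx] n _].
    have [Ox _] := Gx 0 I; split => // -[n _ Knx].
    by have [_] := Gx n.+1 I; apply; rewrite big_ord_recr/=; right.
  split => //; rewrite -bigcup_mkord => -[i _ Kix]; apply: nKx; by exists i.
have nuG : (nu (\bigcap_n G n) <= (e / 2)%:E)%E.
  rewrite GE.
  have sub : O `\` \bigcup_n K n `<=` \bigcup_n ((KO n).2 `\` K n).
    move=> x [[n _ On] nK]; exists n => //; split => // Kn; apply: nK.
    by exists n.
  have mD n : measurable ((KO n).2 `\` K n : set B) by exact: measurableD.
  apply: (le_trans (measure_sigma_subadditive nu mD _ sub)).
    by apply: measurableD => //; exact: bigcupT_measurable.
  apply: (le_trans _ (epsilon_trick0 xpredT (ltW e20))).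
  by apply: lee_nneseries => // n _; have [] := HKO n.
have ndG : nonincreasing_seq G.
  move=> m n mn; apply/subsetPset; apply: setDS; exact: subset_bigsetU.
have mIG : measurable (\bigcap_n G n) by exact: bigcapT_measurable.
have lty n : (nu (G n) < +oo)%E by rewrite ltey_eq unit_mass_fin_num.
have := @nonincreasing_cvg_mu _ _ _ nu G (lty 0) mG mIG ndG.
rewrite -(fineK (unit_mass_fin_num nu1 mIG)) => cv.
have {}cv : fine (nu (G n)) @[n --> \oo] --> fine (nu (\bigcap_n G n)).
  exact: (fine_cvg cv).
move/cvgrPdist_le : cv => /(_ _ e20)[n _ /(_ n (leqnn n))].
rewrite ler_norml => /andP[+ _] => Hn.
exists (\big[setU/set0]_(i < n) K i), O; split => //.
- rewrite -bigcup_mkord; apply: closed_bigcup => //.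
- rewrite -bigcup_mkord => x [i _ Kix]; exists i => //.
  by have [_ _ + _ _] := HKO i; apply.
- move=> x [i _ Eix]; exists i => //.
  by have [_ _ _ + _] := HKO i; apply.
- rewrite -/(G n) -[nu _]fineK ?unit_mass_fin_num// lee_fin.
  move: nuG; rewrite -[nu _]fineK ?unit_mass_fin_num// lee_fin.
  by move: (fine _) (fine _) Hn => p q; lra.
Qed.

(** The regular sets form a sigma-algebra containing the open sets. *)
Lemma borel_regular (E : set B) : measurable E -> forall e : R, 0 < e ->
  exists K O : set X, [/\ closed K, open O, K `<=` E, E `<=` O &
    (nu (O `\` K : set B) <= e%:E)%E].
Proof.
move: E; apply: smallest_sub.
  split.
  - by apply: regular_closed; exact: closed0.
  - by move=> A rA; rewrite setTD; exact: regular_setC.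
  - exact: regular_bigcup.
move=> W oW; rewrite -[W]setCK; apply: regular_setC; apply: regular_closed.
exact: open_closedC.
Qed.

End regularity.

(** Markov's inequality, obtained by integrating [a * \1_A <= g]. *)
Lemma Rintegral_ge_indic d (T : measurableType d) (R : realType)
    (Q : {measure set T -> \bar R}) (A : set T) (g : T -> R) (a M : R) :
  Q setT = 1%E -> measurable A -> measurable_fun setT g ->
  (forall x, `|g x| <= M) -> (forall x, 0 <= g x) -> (forall x, A x -> a <= g x) ->
  a * fine (Q A) <= \int[Q]_x g x.
Proof.
move=> Q1 mA mg gM g0 ag.
have mI : measurable_fun setT (\1_A : T -> R) by exact: measurable_indic.
rewrite -Rintegral_indic// -RintegralZl//; last first.
  exact: (bounded_integrable Q1 mI (@normr_indic_le1 _ _ _ A)).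
have aA x : `|a * \1_A x| <= `|a|.
  by rewrite normrM ler_piMr// normr_indic_le1.
apply: (@le_Rintegral_bounded _ _ _ _ Q1 _ _ (`|a| + M)) => //.
- exact: measurable_funM.
- by move=> x; rewrite (le_trans (aA x))// lerDl (le_trans _ (gM x)).
- by move=> x; rewrite (le_trans (gM x))// lerDr.
- move=> x; rewrite indicE; have [xA|_] := boolP (x \in A).
    by rewrite mulr1; apply: ag; exact: set_mem.
  by rewrite mulr0.
Qed.

(** * A Baire category argument *)

Section baire_charged.
Context (R : realType) (X : completePseudoMetricType R) (rho : X -> X -> R).
Hypotheses (Hrho : is_metric_of rho) (Hsep : separable_space X).
Notation B := (BorelSpace X).
Variables (nu : nat -> {measure set B -> \bar R}) (C : nat -> set X).
Hypothesis nu0 : (0 < nu 0 setT)%E.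
Hypothesis closedC : forall N, closed (C N).
Hypothesis coverC : forall x, exists N, C N x.

Let charged (y : X) := exists n, forall s, 0 < s -> (0 < nu n (ball y s : set B))%E.
Let state := {p : X * R | charged p.1 /\ 0 < p.2}.

(* Baire's argument, restricted to centers charged by one of the measures. *)
Lemma exists_charged_ball : exists (w : X) (r : R) (N n0 : nat), [/\ 0 < r,
  (0 < nu n0 (ball w r : set B))%E &
  forall n, nu n (ball w r `\` C N : set B) = 0%E].
Proof.
apply: contrapT => Hno.
(* If no ball works, some measure charges the open set [ball w r] minus [C N], which therefore
   contains a charged point and a smaller ball around it. *)
have step (a : nat * state) : exists q : state,
    (sval q).2 <= (sval a.2).2 / 2 /\
    ball (sval q).1 (2 * (sval q).2) `<=`
      ball (sval a.2).1 (sval a.2).2 `\` C a.1.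
  case: a => N [[w r] [/= [n0 cw] r0]] /=.
  have oD : open (ball w r `\` C N).
    by apply: openI; [exact: metric_ball_open Hrho _ _|exact: closed_openC].
  have [n nun] : exists n, (0 < nu n (ball w r `\` C N : set B))%E.
    apply: contrapT => H; apply: Hno; exists w, r, N, n0; split => //.
      exact: cw.
    move=> n; apply: contrapT => nu0'; apply: H; exists n.
    by rewrite lt_neqAle measure_ge0 andbT eq_sym; apply/eqP.
  have [y Dy cy] := exists_charged_point Hrho Hsep oD nun.
  have /nbhs_ballP[s /= s0 sD] : nbhs y (ball w r `\` C N).
    exact: open_nbhs_nbhs.
  (* Halving [s] fits the doubled ball into the open set; halving [r] makes the radii tend to 0. *)
  pose t := Num.min (s / 2) (r / 2).
  have t0 : 0 < t by rewrite lt_min !divr_gt0.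
  have cyt : charged (y, t).1 /\ 0 < (y, t).2 by split => //; exists n.
  exists (exist _ (y, t) cyt); split => /=; first by rewrite ge_min lexx orbT.
  apply: subset_trans sD; apply: le_ball.
  by rewrite mulrC -ler_pdivlMr// ge_min lexx.
have [f Hf] := choice step.
have [y0 _ cy0] := exists_charged_point Hrho Hsep openT nu0.
have cy01 : charged (y0, 1 : R).1 /\ 0 < (y0, 1 : R).2 by split => //; exists 0%N.
pose s := fix s k : state := if k is k'.+1 then f (k', s k')
  else exist _ (y0, 1 : R) cy01.
pose x k := (sval (s k)).1; pose r k := (sval (s k)).2.
have r0 k : 0 < r k by have [] := svalP (s k).
have rS k : r k.+1 <= r k / 2 by have [] := Hf (k, s k).
have xS k : ball (x k.+1) (2 * r k.+1) `<=` ball (x k) (r k) `\` C k.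
  by have [] := Hf (k, s k).
have rle k : r k <= 1 / (2 ^ k)%:R.
  elim: k => [|k IHk]; first by rewrite expn0 divr1.
  rewrite (le_trans (rS k))// expnSr natrM invfM mulrA.
  by rewrite ler_pM2r.
have ballS k : ball (x k.+1) (r k.+1) `<=` ball (x k) (r k).
  move=> y /(le_ball (_ : r k.+1 <= 2 * r k.+1)) H.
  have /H/xS[] // : r k.+1 <= 2 * r k.+1 by rewrite ler_pMl ?ler1n.
have ballD k j : ball (x (k + j)%N) (r (k + j)%N) `<=` ball (x k) (r k).
  elim: j => [|j IHj]; first by rewrite addn0.
  by rewrite addnS; apply: subset_trans IHj.
have xball k j : (k <= j)%N -> ball (x k) (r k) (x j).
  by move=> kj; rewrite -(subnKC kj); apply: ballD; exact: ballxx.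
have cx : cauchy (x j @[j --> \oo]).
  apply: cauchy_exP => e e0.
  have [k ke] : exists k, r k <= e.
    have [k _ /(_ k (leqnn k))] := near_infty_natSinv_lt (PosNum e0).
    move=> /= /ltW ke; exists k; rewrite (le_trans (rle k))// (le_trans _ ke)//.
    by rewrite div1r lef_pV2 ?posrE ?ltr0n ?expn_gt0// ler_nat ltn_expl.
  by exists (x k); exists k => // j kj; apply: (le_ball ke); exact: xball.
pose l := lim (x j @[j --> \oo]).
have xl : x j @[j --> \oo] --> l by exact: cauchy_cvg.
have [N CNl] := coverC l.
(* The limit is only known to lie in the closure of each ball, hence in the doubled ball, which
   avoids [C N]: a contradiction. *)
have /xS[] : ball (x N.+1) (2 * r N.+1) l; last by [].
have := xl _ (nbhsx_ballx l _ (r0 N.+1)) => -[j _ jl].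
rewrite mulrDl mul1r.
apply: (ball_triangle (xball _ (maxn j N.+1) (leq_maxr _ _))).
by apply: ball_sym; apply: jl; exact: leq_maxl.
Qed.

End baire_charged.

(** * Invariant probability and main theorem *)

Section invariant_existence.
Context (R : realType) (X : completePseudoMetricType R) (rho : X -> X -> R).
Hypotheses (Hrho : is_metric_of rho) (Hsep : separable_space X).
Notation B := (BorelSpace X).
Variable P : R -> R.-pker B ~> B.
Hypothesis HCK : forall s t : R, 0 <= s -> 0 <= t ->
  forall (x : B) (A : set B), measurable A ->
  P (s + t) x A = (\int[P s x]_y P t y A)%E.
Hypothesis HFeller : forall t : R, 0 <= t -> forall f : X -> R, continuous f ->
  (exists M : R, forall x, `|f x| <= M) -> continuous (Ptf P t f : X -> R).
Hypothesis merge : merging P 0.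
Variable z : X.
Hypothesis HC1 : forall r : R, 0 < r -> exists2 c : R, 0 < c &
  exists N : nat, forall n, (N <= n)%N -> c <= fine (P n%:R z (ball z r : set B)).

Let P1 t x : P t x setT = 1%E. Proof. exact: prob_kernel. Qed.

Let nu (n : nat) := P n%:R z.

Let unit_ball_indic (A : set B) : measurable A -> unit_ball (\1_A : B -> R).
Proof. by move=> mA; split; [exact: measurable_indic|exact: normr_indic_le1]. Qed.

Let Ptf_indic t x (A : set B) : measurable A -> Ptf P t (\1_A) x = fine (P t x A).
Proof. by move=> mA; rewrite /Ptf Rintegral_indic. Qed.

(** The law at time [t + n] is also the law at time [n] started from [P t z], and this merges with
    the orbit started from the Dirac mass at [z]. *)
Lemma asymp_invariant_orbit (t : R) (A : set B) : 0 <= t -> measurable A ->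
  forall e : R, 0 < e ->
  \forall n \near \oo, fine (pushK (P t) (nu n) A) <= fine (nu n A) + e.
Proof.
move=> t0 mA e e0.
have d1 : (\d_(z : B) : {measure set B -> \bar R}) setT = 1%E by exact: diracT.
have [N HN] := merging_measures HCK merge (P1 t z) d1 e0.
exists N => // n /= Nn; have {HN}/HN : N%:R <= n%:R :> R by rewrite ler_nat.
move=> /(_ _ (unit_ball_indic mA)).
rewrite Rintegral_dirac; last by have [] := unit_ball_Ptf P n%:R (unit_ball_indic mA).
have FA := unit_ball_indic mA.
rewrite -(PtfD HCK)// (addrC t) !Ptf_indic// HCK//.
by move=> H; rewrite -lerBlDl; exact: le_trans (ler_norm _) H.
Qed.

(** Test functions are restricted to continuous ones so that the Feller property makes these sets
    closed; merging makes them cover the space. *)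
Let C (N : nat) : set X := [set u | forall n, (N <= n)%N ->
  forall f : X -> R, continuous f -> (forall x, `|f x| <= 1) ->
  `|Ptf P n%:R f u - Ptf P n%:R f z| <= 1 / 4].

Let closed_C N : closed (C N).
Proof.
have -> : C N = \bigcap_(p in [set p : nat * (X -> R) | [/\ (N <= p.1)%N,
    continuous p.2 & forall x, `|p.2 x| <= 1]])
    [set u | `|Ptf P p.1%:R p.2 u - Ptf P p.1%:R p.2 z| <= 1 / 4].
  apply/seteqP; split => [u Cu [n f] [/= Nn cf f1]|u Hu n Nn f cf f1].
    exact: Cu.
  exact: (Hu (n, f)).
apply: closed_bigI => -[n f] [/= Nn cf f1].
have cP : continuous (fun u : X => `|Ptf P n%:R f u - Ptf P n%:R f z|).
  move=> u; apply: cvg_norm; apply: cvgB; last exact: cvg_cst.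
  by apply: HFeller => //; exists 1.
exact: (closed_comp (fun u _ => cP u) (@closed_le R (1 / 4))).
Qed.

Let cover_C x : exists N, C N x.
Proof.
have d1 (y : X) : (\d_(y : B) : {measure set B -> \bar R}) setT = 1%E.
  exact: diracT.
have e0 : 0 < 1 / 4 :> R by rewrite divr_gt0.
have [N HN] := merging_measures HCK merge (d1 x) (d1 z) e0.
exists N => n Nn f cf f1; have {HN}/HN : N%:R <= n%:R :> R by rewrite ler_nat.
have Ff : unit_ball (f : B -> R) by split => //; exact: continuous_borel.
move=> /(_ _ Ff); have [mPf _] := unit_ball_Ptf P n%:R Ff.
by rewrite !Rintegral_dirac.
Qed.

(** From [z] the ball is reached in [n0] steps with positive probability, and by the Feller property
    this persists, uniformly, on a ball around [z]. C1 makes the orbit of [z] return there with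
    probability at least [c] at all late times. *)
Let charged_lower_bound (w : X) (r : R) (n0 : nat) : 0 < r ->
  (0 < nu n0 (ball w r : set B))%E ->
  exists2 c : R, 0 < c & \forall n \near \oo, c <= fine (nu n (ball w r : set B)).
Proof.
move=> r0 nuw.
have [rho0 _ _ _ _] := Hrho.
have mball x s : measurable (ball x s : set B).
  by apply: open_borel; exact: metric_ball_open Hrho _ _.
(* A continuous bump, positive exactly on the ball and at most [r], replaces the indicator to which
   the Feller property does not apply. *)
pose phi v := Num.max 0 (r - rho w v).
have cphi : continuous phi.
  move=> v; apply: (@continuous_max R X (cst 0) (fun v => r - rho w v)).
    exact: cvg_cst.
  by apply: cvgB; [exact: cvg_cst|exact: metric_continuous Hrho _ _].
have phi0 v : 0 <= phi v by rewrite le_max lexx.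
have phir v : `|phi v| <= r.
  by rewrite ger0_norm// ge_max ltW//= gerBl.
have mphi : measurable_fun [set: B] (phi : B -> R) by exact: continuous_borel.
have phi_pos v : ball w r v -> 0 < phi v.
  by rewrite (metric_ballE Hrho)/= => wv; rewrite lt_max subr_gt0 wv orbT.
have phi_zero v : ~ ball w r v -> phi v = 0.
  rewrite (metric_ballE Hrho)/= => /negP; rewrite -leNgt => wv.
  by apply/max_idPl; rewrite subr_le0.
pose b := Ptf P n0%:R phi z.
have b0 : 0 < b.
  have [j nuj] : exists j : nat,
      (0 < nu n0 [set v : B | (j.+1%:R^-1 <= phi v)%R])%E.
    apply: contrapT => H.
    have mj j : measurable [set v : B | (j.+1%:R^-1 <= phi v)%R].
      exact: measurable_superlevel.
    have : (nu n0).-negligible (ball w r : set B).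
      apply: (@negligibleS _ _ _ _ (\bigcup_j [set v : B | (j.+1%:R^-1 <= phi v)%R])).
        move=> v /phi_pos pv.
        have [j _ /(_ j (leqnn j))] := near_infty_natSinv_lt (PosNum pv).
        by move=> /ltW jv; exists j.
      apply: negligible_bigcup => j; apply/negligibleP; first exact: mj.
      apply: contrapT => nu0; apply: H; exists j.
      by rewrite lt_neqAle measure_ge0 andbT eq_sym; apply/eqP.
    move=> /negligibleP => /(_ (mball _ _)) nu0.
    by rewrite nu0 ltxx in nuw.
  have mj : measurable [set v : B | (j.+1%:R^-1 <= phi v)%R].
    exact: measurable_superlevel.
  apply: (@lt_le_trans _ _ (j.+1%:R^-1 * fine (nu n0 [set v : B | (j.+1%:R^-1 <= phi v)%R]))).
    rewrite mulr_gt0 ?invr_gt0// fine_gt0// nuj/=.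
    by rewrite ltey_eq unit_mass_fin_num ?P1.
  by apply: Rintegral_ge_indic mphi phir phi0 _ => //; exact: P1.
have [d d0 Hd] : exists2 d : R, 0 < d & forall u, ball z d u -> b / 2 <= Ptf P n0%:R phi u.
  have : Ptf P n0%:R phi u @[u --> (z : X)] --> Ptf P n0%:R phi z.
    by apply: HFeller => //; exists r.
  move=> /cvgrPdist_le/(_ (b / 2)).
  rewrite divr_gt0// => /(_ isT) /nbhs_ballP[d /= d0 Hd]; exists d => // u /Hd.
  by rewrite ler_norml -/b => /andP[_]; move: (Ptf _ _ _ _) => p; lra.
have [c c0 [N HN]] := HC1 d0.
(* Near [z] the mean of [phi] after [n0] steps is at least [b / 2]; since [phi] is at most [r] times
   the indicator of the ball, the ball then has mass at least [b / 2 / r]. *)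
exists (b / 2 / r * c); first by rewrite !(mulr_gt0, divr_gt0, invr_gt0).
exists (N + n0)%N => // m /= mN.
have n0m : (n0 <= m)%N by rewrite (leq_trans _ mN)// leq_addl.
have Nm : (N <= m - n0)%N by rewrite leq_subRL// addnC.
have FA := unit_ball_indic (mball w r).
rewrite -Ptf_indic// -(subnK n0m) addnC (Rintegral_Ptf_nat HCK)//.
have [mg g1] := unit_ball_Ptf P n0%:R (unit_ball_indic (mball w r)).
have br0 : 0 <= b / 2 / r by rewrite !divr_ge0// ltW.
apply: (le_trans (ler_wpM2l br0 (HN _ Nm))).
apply: (Rintegral_ge_indic (P1 _ _) (mball _ _) mg g1).
  by move=> x; rewrite Ptf_indic// fine_ge0.
move=> u /Hd Hu; rewrite ler_pdivrMr// (le_trans Hu)// mulrC.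
rewrite /Ptf -RintegralZl//; last first.
  exact: (bounded_integrable (P1 _ _) (unit_ball_indic (mball w r)).1
    (unit_ball_indic (mball w r)).2).
apply: (@le_Rintegral_bounded _ _ _ _ (P1 n0%:R u) _ _ r) => //.
- by apply: measurable_funM => //; exact: measurable_indic.
- by move=> x; rewrite normrM gtr0_norm// ler_piMr ?normr_indic_le1// ltW.
- move=> x; rewrite indicE; have [xA|xA] := boolP (x \in _).
    by rewrite mulr1 (le_trans (ler_norm _)).
  by rewrite mulr0 phi_zero//; move: xA; rewrite notin_setE.
Qed.

(** At late times the orbit of [z] puts mass at least [c] on [C N], from which [N] further steps
    reproduce [nu N] up to [1 / 4] on continuous functions. Passing to Borel sets by regularity
    costs [1 / 8] on each side, for a total of [1 / 2]. *)
Lemma asymp_minorized : exists (N : nat) (c : R), 0 < c /\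
  forall E : set B, measurable E ->
  \forall n \near \oo, c * (fine (nu N E) - 1 / 2) <= fine (nu n E).
Proof.
have nu0 : (0 < nu 0 setT)%E by rewrite P1.
have [w [r [N [n0 [r0 nuw nuC]]]]] :=
  exists_charged_ball Hrho Hsep nu0 closed_C cover_C.
have [c c0 [M _ HM]] := charged_lower_bound r0 nuw.
exists N, c; split => // E mE.
have mball : measurable (ball w r : set B).
  by apply: open_borel; exact: metric_ball_open Hrho _ _.
have mC : measurable (C N : set B) by exact: closed_borel.
have nuCN s : (M <= s)%N -> c <= fine (nu s (C N : set B)).
  move=> /HM/le_trans; apply; apply: fine_le; rewrite ?unit_mass_fin_num ?P1//.
  (* The part of the ball outside [C N] is null for every [nu s]. *)
  have -> : nu s (ball w r : set B) = nu s (ball w r `&` C N : set B).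
    have E1 : (nu s (ball w r : set B) = nu s (ball w r `\` C N : set B) +
        nu s (ball w r `&` C N : set B))%E by exact: measureDI.
    by rewrite E1 nuC add0e.
  by apply: le_measure; rewrite ?inE//; exact: measurableI.
have smooth s (f : X -> R) : (M <= s)%N -> continuous f ->
    (forall x, 0 <= f x <= 1) ->
    c * (Ptf P N%:R f z - 1 / 4) <= Ptf P (s + N)%:R f z.
  move=> Ms cf f01.
  have f1 x : `|f x| <= 1 by have /andP[? ?] := f01 x; rewrite ger0_norm.
  have Ff : unit_ball (f : B -> R) by split => //; exact: continuous_borel.
  have g0 x : 0 <= Ptf P N%:R f x.
    by apply: Rintegral_ge0 => y _; have /andP[] := f01 y.
  have [mg g1] := unit_ball_Ptf P N%:R Ff.
  rewrite addnC (Rintegral_Ptf_nat HCK)//.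
  (* The lower bound [c] on the mass of [C N] may only be multiplied by a nonnegative factor;
     otherwise the claim is trivial. *)
  have [a0|a0] := leP (Ptf P N%:R f z - 1 / 4) 0.
    apply: (@le_trans _ _ 0); first by rewrite mulr_ge0_le0// ltW.
    exact: Rintegral_ge0.
  rewrite mulrC (le_trans (ler_wpM2l (ltW a0) (nuCN _ Ms)))//.
  apply: (Rintegral_ge_indic (P1 _ _) mC mg g1 g0).
  move=> u /(_ N (leqnn N) f cf f1); rewrite ler_norml => /andP[+ _].
  by move: (Ptf P N%:R f u) (Ptf P N%:R f z) => p q; lra.
exists (M + N)%N => // n /= MNn.
have Nn : (N <= n)%N by rewrite (leq_trans _ MNn)// leq_addl.
have Mn : (M <= n - N)%N by rewrite leq_subRL// addnC.
have e1 : 0 < 1 / 8 :> R by rewrite divr_gt0.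
have e2 : 0 < c / 8 by rewrite divr_gt0.
(* [E] is approximated from inside for the law at time [N] and from outside for the law at time [n].
   The function between them depends on [n], which is harmless because [smooth] holds for all [f]
   from the same time on. *)
have [K [W1 [cK oW1 KE EW1 nuK]]] := borel_regular Hrho (P1 N%:R z) mE e1.
have [K2 [W [cK2 oW K2E EW nuW]]] := borel_regular Hrho (P1 n%:R z) mE e2.
have [f [cf f01 fK fW]] := closed_open_separation cK oW (subset_trans KE EW).
have := smooth _ f Mn cf f01; rewrite subnK// => Hf.
have mK : measurable (K : set B) by exact: closed_borel.
have mK2 : measurable (K2 : set B) by exact: closed_borel.
have mW : measurable (W : set B) by exact: open_borel.
have mW1 : measurable (W1 : set B) by exact: open_borel.
have f1 x : `|f x| <= 1 by have /andP[? ?] := f01 x; rewrite ger0_norm.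
have mf : measurable_fun [set: B] (f : B -> R) by exact: continuous_borel.
have H1 : fine (nu N (K : set B)) <= Ptf P N%:R f z.
  rewrite -[leLHS]mul1r; apply: (Rintegral_ge_indic (P1 _ _) mK mf f1).
  - by move=> x; have /andP[] := f01 x.
  - by move=> x Kx; rewrite fK.
have H2 : Ptf P n%:R f z <= fine (nu n (W : set B)).
  rewrite -Ptf_indic//; apply: (@le_Rintegral_bounded _ _ _ _ (P1 n%:R z) _ _ 1) => //.
  - exact: normr_indic_le1.
  - move=> x; rewrite indicE; have [xW|xW] := boolP (x \in _).
      by have /andP[] := f01 x.
    by rewrite fW//; move: xW; rewrite notin_setE.
have fineD1 (m : {measure set B -> \bar R}) (U V V' : set B) (e : R) :
    m setT = 1%E -> measurable U -> measurable V -> measurable V' ->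
    U `<=` V -> V `<=` V' -> (m (V' `\` U) <= e%:E)%E ->
    fine (m V') <= fine (m U) + e.
  move=> m1 mU mV mV' UV VV' me.
  have UV' : U `<=` V' by exact: subset_trans VV'.
  have -> : (m V' = m (V' `\` U) + m U)%E.
    by rewrite -[in X in (_ + X)%E](setIidr UV'); exact: measureDI.
  rewrite fineD ?unit_mass_fin_num//; last exact: measurableD.
  rewrite addrC lerD2l -lee_fin fineK// unit_mass_fin_num//.
  exact: measurableD.
have H3 : fine (nu N E) <= fine (nu N (K : set B)) + 1 / 8.
  apply: (@le_trans _ _ (fine (nu N (W1 : set B)))).
    by apply: fine_le; rewrite ?unit_mass_fin_num ?P1//; apply: le_measure; rewrite ?inE.
  exact: (fineD1 _ _ E _ _ (P1 _ _)).
have H4 : fine (nu n (W : set B)) <= fine (nu n E) + c / 8.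
  apply: (@le_trans _ _ (fine (nu n (K2 : set B)) + c / 8)).
    exact: (fineD1 _ _ E _ _ (P1 _ _)).
  rewrite lerD2r.
  by apply: fine_le; rewrite ?unit_mass_fin_num ?P1//; apply: le_measure; rewrite ?inE.
apply: (@le_trans _ _ (c * (Ptf P N%:R f z - 1 / 4) - c / 8)).
  rewrite -mulrBr ler_wpM2l ?(ltW c0)//.
  by move: H1 H3; move: (fine _) (fine _) (Ptf _ _ _ _) => p q s; lra.
by rewrite lerBlDr (le_trans Hf)// (le_trans H2).
Qed.

Lemma exists_invariant : exists mu : probability B R,
  forall t, 0 <= t -> forall A, measurable A -> pushK (P t) mu A = mu A.
Proof.
have [N [c [c0 HE]]] := asymp_minorized.
have [mu Hmu] := @exists_invariant_probability _ B R {nonneg R} nu (nu N)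
  (fun t => P t%:num) c (1 / 2) (fun n => P1 _ _) (P1 _ _)
  (fun t A mA => asymp_invariant_orbit (ge0 t) mA) c0 ltac:(by lra) HE.
by exists mu => t t0 A mA; exact: (Hmu (NngNum t0)).
Qed.

End invariant_existence.

(** * Convergence in total variation as a uniform estimate *)

Section total_variation.
Context (R : realType) (X : pointedType) (TX : set (set X)).
Notation B := (g_sigma_algebraType TX).
Variables (m : R -> {measure set B -> \bar R}) (mu : {measure set B -> \bar R}).
Hypotheses (m1 : forall t, m t setT = 1%E) (mu1 : mu setT = 1%E).

Let tv_term t (f : X -> R) : unit_ball_Bfun TX f ->
  (`|\int[m t]_x f x - \int[mu]_x f x|)%:E =
  (`| \int[m t]_x (f x)%:E - \int[mu]_x (f x)%:E |)%E.
Proof.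
move=> [mf f1].
by rewrite -(Rintegral_bounded_EFin (m1 t) mf f1) -(Rintegral_bounded_EFin mu1 mf f1).
Qed.

Let tv_dist_ge0 t : (0 <= tv_dist (m t) mu)%E.
Proof.
have F0 : unit_ball_Bfun TX (cst 0 : X -> R) by split => // x; rewrite normr0.
apply: (le_trans _ (ereal_sup_ubound (imageP _ F0))).
exact: abse_ge0.
Qed.

Let tv_dist_le t (e : R) : (tv_dist (m t) mu <= e%:E)%E <->
  forall f, unit_ball_Bfun TX f -> `|\int[m t]_x f x - \int[mu]_x f x| <= e.
Proof.
split => [te f Ff|H].
  rewrite -lee_fin tv_term//; apply: le_trans te.
  exact: (ereal_sup_ubound (imageP _ Ff)).
by apply: ge_ereal_sup => _ [f Ff <-]; rewrite -tv_term// lee_fin H.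
Qed.

Lemma tv_dist_cvg0P : (tv_dist (m t) mu @[t --> +oo] --> 0%E) <->
  forall e : R, 0 < e -> \forall t \near +oo,
    forall f, unit_ball_Bfun TX f -> `|\int[m t]_x f x - \int[mu]_x f x| <= e.
Proof.
split => [cv e e0|H].
  have /fine_cvgP[ffin /cvgrPdist_le/(_ e e0) fe] := cv.
  apply: filterS2 ffin fe => t ft te; apply/tv_dist_le.
  rewrite -(fineK ft) lee_fin; apply: le_trans te.
  by rewrite sub0r normrN /= ler_norm.
have fin t e : (tv_dist (m t) mu <= e%:E)%E -> tv_dist (m t) mu \is a fin_num.
  by move=> te; rewrite ge0_fin_numE// (le_lt_trans te)// ltry.
apply/fine_cvgP; split.
  by apply: filterS (H 1 ltr01) => t /tv_dist_le; exact: fin.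
apply/cvgrPdist_le => e e0; apply: filterS (H e e0) => t /tv_dist_le te.
rewrite sub0r normrN /= ger0_norm ?fine_ge0//.
by rewrite -lee_fin fineK// (fin _ _ te).
Qed.

End total_variation.

(** * Equivalence of stability with eventual continuity and C1 *)

Theorem mainTheorem7 (R : realType) (X : completePseudoMetricType R)
  (rho : X -> X -> R) (Hrho : is_metric_of rho) (Hsep : separable_space X)
  (P : R -> R.-pker (BorelSpace X) ~> (BorelSpace X))
  (HP0 : forall (x : BorelSpace X) (A : set (BorelSpace X)), measurable A ->
     P 0 x A = \d_x A)
  (HCK : forall s t : R, 0 <= s -> 0 <= t ->
     forall (x : X) (A : set (BorelSpace X)), measurable A ->
     P (s + t) x A = (\int[P s x]_y P t y A)%E)
  (HFeller : forall t : R, 0 <= t -> forall f : X -> R, continuous f ->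
     (exists M : R, forall x, `|f x| <= M) -> continuous (Pf P t f))
  (Hrcont : forall f : X -> R, continuous f ->
     (exists M : R, forall x, `|f x| <= M) -> forall (x : X) (t : R), 0 <= t ->
     Pf P s f x @[s --> t^'+] --> Pf P t f x) :
  let F := @unit_ball_Bfun R X (@open X) in
  let invariant (mu : probability (BorelSpace X) R) :=
    forall t : R, 0 <= t -> forall A : set (BorelSpace X), measurable A ->
      pushK (P t) mu A = mu A in
  let uec_at (x : X) :=
    forall eps : R, 0 < eps -> exists2 delta : R, 0 < delta &
      forall x' : X, ball x delta x' -> exists T : R, forall t : R, 0 <= t -> T <= t ->
        forall f : X -> R, F f -> `|Pf P t f x' - Pf P t f x| <= eps in
  let C1_at (z : X) :=
    forall r : R, 0 < r -> exists2 c : R, 0 < c &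
      forall x : X, exists T : R, forall t : R, 0 <= t -> T <= t ->
        (c%:E <= P t x (ball z r : set (BorelSpace X)))%E in
  let cond_i :=
    exists mu : probability (BorelSpace X) R,
      [/\ invariant mu,
          (forall mu' : probability (BorelSpace X) R, invariant mu' ->
             forall A : set (BorelSpace X), measurable A -> mu' A = mu A) &
          (forall nu : probability (BorelSpace X) R,
             tv_dist (pushK (P t) nu) mu @[t --> +oo] --> 0%E)] in
  let cond_ii := (forall x : X, uec_at x) /\ exists z : X, C1_at z in
  let cond_iii := exists z : X, uec_at z /\ C1_at z in
  (cond_i <-> cond_ii) /\ (cond_ii <-> cond_iii).
Proof.
move=> F invariant uec_at C1_at cond_i cond_ii cond_iii.
have mball x r : measurable (ball x r : set (BorelSpace X)).
  by apply: open_borel; exact: metric_ball_open Hrho _ _.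
have P1 t x : P t x setT = 1%E by exact: prob_kernel.
have F1 (A : set (BorelSpace X)) : measurable A -> F (\1_A : X -> R).
  by move=> mA; split; [exact: measurable_indic|
    exact: (@normr_indic_le1 _ (BorelSpace X))].
have i_ii : cond_i -> cond_ii.
  move=> [mu [_ _ tv]].
  have mu1 : mu setT = 1%E by exact: probability_setT.
  have cv (x : X) (e : R) : 0 < e -> exists T : R, forall t, T <= t ->
      forall f, F f -> `|Pf P t f x - \int[mu]_y f y| <= e.
    move=> e0.
    have d1 : (\d_(x : BorelSpace X) : {measure set _ -> \bar R}) setT = 1%E.
      exact: diracT.
    have /(tv_dist_cvg0P (fun t => pushK_setT (P t) d1) mu1)/(_ e e0) := tv \d_(x : BorelSpace X).
    (* The filter at [+oo] gives the estimate only for [T < t], whence the shift by 1. *)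
    move=> [T [_ HT]]; exists (T + 1) => t Tt f Ff.
    have {HT}/HT : T < t by rewrite (lt_le_trans _ Tt)// ltrDl.
    move=> /(_ f Ff); have [mf f1] := Ff.
    rewrite (Rintegral_pushK (P t) d1 mf f1) Rintegral_dirac//.
    exact: (measurable_fun_Rintegral_kernel (P t) mf f1).
  split.
    (* Any radius would do: all orbits approach [mu], so any two of them are asymptotically
       close. *)
    move=> x eps eps0; exists 1 => // x' _.
    have e20 : 0 < eps / 2 by rewrite divr_gt0.
    have [T1 HT1] := cv x _ e20; have [T2 HT2] := cv x' _ e20.
    exists (Num.max T1 T2) => t _; rewrite ge_max => /andP[T1t T2t] f Ff.
    have -> : Pf P t f x' - Pf P t f x =
        (Pf P t f x' - \int[mu]_y f y) - (Pf P t f x - \int[mu]_y f y) by ring.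
    rewrite (le_trans (ler_normB _ _))// (splitr eps) lerD//.
      exact: HT2.
    exact: HT1.
  have muT : (0 < mu setT)%E by rewrite mu1.
  have [z _ cz] := exists_charged_point Hrho Hsep openT muT.
  exists z => r r0; pose c := fine (mu (ball z r : set (BorelSpace X))).
  have c0 : 0 < c.
    by rewrite fine_gt0// cz//= ltey_eq (unit_mass_fin_num mu1).
  have c20 : 0 < c / 2 by rewrite divr_gt0.
  (* The mass of the ball tends to its [mu]-mass [c] from every starting point, so it eventually
     exceeds [c / 2]. *)
  exists (c / 2) => // x; have [T HT] := cv x _ c20; exists T => t _ Tt.
  rewrite -(fineK (unit_mass_fin_num (P1 t x) (mball z r))) lee_fin.
  have := HT t Tt _ (F1 _ (mball z r)).
  rewrite /Pf !Rintegral_indic// -/c ler_norml => /andP[+ _].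
  by move: (fine _) => p; lra.
have ii_iii : cond_ii -> cond_iii by move=> [uec [z C1z]]; exists z.
have iii_i : cond_iii -> cond_i.
  move=> [z [uz C1z]].
  (* The ball on which eventual continuity at [z] holds with error [eps] is charged by every orbit,
     by C1. *)
  have merge : merging P 0.
    apply: (@merging0 _ (BorelSpace X) R P HCK z) => eps eps0.
    have [d d0 Hd] := uz _ eps0; have [c c0 Hc] := C1z _ d0.
    by exists (ball z d), c; split.
  have C1n r : 0 < r -> exists2 c : R, 0 < c & exists N : nat, forall n,
      (N <= n)%N -> c <= fine (P n%:R z (ball z r : set (BorelSpace X))).
    move=> r0; have [c c0 Hc] := C1z _ r0; exists c => //.
    have [N HN] := nat_threshold (Hc z); exists N => n /HN.
    by rewrite -(fineK (unit_mass_fin_num (P1 _ z) (mball z r))).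
  have [mu mu_inv] := exists_invariant Hrho Hsep HCK HFeller merge C1n.
  have mu1 : mu setT = 1%E by exact: probability_setT.
  have Rint_inv (m : probability (BorelSpace X) R) : invariant m ->
      forall t f, 0 <= t -> F f -> \int[m]_x Ptf P t f x = \int[m]_x f x.
    move=> m_inv t f t0 [mf f1].
    rewrite -(Rintegral_pushK (P t) (probability_setT m) mf f1).
    by apply: eq_measure_Rintegral => A mA; exact: m_inv.
  exists mu; split => //.
    (* Invariant laws do not move, yet their evolutions merge, so they differ by at most every
       [e > 0]. *)
    move=> mu' mu'_inv A mA.
    have mu'1 : mu' setT = 1%E by exact: probability_setT.
    rewrite -(fineK (unit_mass_fin_num mu1 mA)) -(fineK (unit_mass_fin_num mu'1 mA)).
    congr EFin; apply/eqP; rewrite -subr_eq0 -normr_le0; apply/ler_addgt0Pr => e e0.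
    have [N HN] := @merging_measures _ (BorelSpace X) _ _ HCK merge _ _ mu'1 mu1 _ e0.
    have FA := F1 _ mA; have N0 := ler0n R N; have := HN _ (lexx _) _ FA.
    rewrite add0r (Rint_inv _ mu'_inv _ _ N0 FA) (Rint_inv _ mu_inv _ _ N0 FA).
    by rewrite !Rintegral_indic.
  move=> nu; have nu1 : nu setT = 1%E by exact: probability_setT.
  apply/(tv_dist_cvg0P (fun t => pushK_setT (P t) nu1) mu1) => e e0.
  have [N HN] := @merging_measures _ (BorelSpace X) _ _ HCK merge _ _ nu1 mu1 _ e0.
  exists N%:R; split; first exact: num_real.
  move=> t /ltW Nt f Ff; have := HN t Nt f Ff; have [mf f1] := Ff.
  have t0 : 0 <= t by exact: le_trans (ler0n R N) Nt.
  by rewrite (Rint_inv _ mu_inv _ _ t0 Ff) (Rintegral_pushK (P t) nu1 mf f1).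
by split; split => // H; [apply: iii_i; exact: ii_iii|apply: i_ii; exact: iii_i].
Qed.
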